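(* Let $q\ge 4$ be a power of $2$, let $D$ be the standard derivation set on the line at infinity $\ell_\infty$ of $\mathrm{PG}(2,q^2)$, and let $K$ be a conic of $\mathrm{PG}(2,q^2)$. Then the following hold. (a) If $K$ is a hyperbola having two non-conjugate points on $\ell_\infty\setminus D$, or if $K$ is an ellipse, then every line of the Hall plane $\mathrm{Hall}(q^2)$ intersects the affine part of $K$ in at most $4$ points, and the number of (unordered) triples of distinct points of the affine part of $K$ that are collinear in the Hall plane is $\binom{q+1}{3}$. (b) If $K$ is a hyperbola having exactly one point in $D$, then every line of the Hall plane intersects the affine part of $K$ in at most $3$ points, and the number of (unordered) triples of distinct points of the affine part of $K$ that are collinear in the Hall plane is $\binom{q}{3}$.
   Context: Use homogeneous coordinates $(X:Y:Z)$ in $\mathrm{PG}(2,q^2)$ with line at infinity $\ell_\infty: Z=0$, so $\mathrm{AG}(2,q^2)=\mathrm{PG}(2,q^2)\setminus\ell_\infty$. The standard derivation set is $D=\{(x:y:0)\mid x,y\in\mathrm{GF}(q),\ (x,y)\neq(0,0)\}\subset\ell_\infty$. The affine Hall plane $\mathrm{Hall}(q^2)$ has as points the points of $\mathrm{AG}(2,q^2)$; its lines are the ''old lines'', i.e. the affine parts of the lines of $\mathrm{PG}(2,q^2)$ other than $\ell_\infty$ whose infinite point is not in $D$, and the ''new lines'', i.e. the affine parts $B\setminus\ell_\infty$ of the Baer subplanes $B$ (subplanes of order $q$) of $\mathrm{PG}(2,q^2)$ containing $D$; explicitly, the new lines are the sets $\{(a+\lambda u,b+\lambda v): u,v\in\mathrm{GF}(q)\}$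 with $a,b\in\mathrm{GF}(q^2)$, $\lambda\in\mathrm{GF}(q^2)^*$. Conic means irreducible conic. A conic is an ellipse or a hyperbola if it has exactly $0$ or $2$ points on $\ell_\infty$, respectively; its affine part is $K\setminus\ell_\infty$. Two points of $\ell_\infty\setminus D$ are conjugate (with respect to $D$) if they are interchanged by $(x:y:0)\mapsto(x^q:y^q:0)$. *)

(* Defs.v *)
From HB Require Import structures.
From mathcomp Require Import all_boot all_order all_algebra.
From mathcomp Require Import mpoly.

Set Implicit Arguments.
Unset Strict Implicit.
Unset Printing Implicit Defensive.

Import GRing.Theory.
Local Open Scope ring_scope.

Section Plane.

Variable F : finFieldType.

(* A point with homogeneous coordinates v is encoded as <<v>>, the canonical
   matrix of the row space of v: two nonzero vectors give the same matrix
   exactly when they are proportional. *)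
Definition pg_points : {set 'M[F]_3} :=
  [set P | [exists v : 'rV[F]_3, (v != 0) && (P == <<v>>%MS)]].

Definition hpoint (x y z : F) : 'M[F]_3 :=
  <<\row_(i < 3) nth 0 [:: x; y; z] i>>%MS.

Definition line_of (l : 'cV[F]_3) : {set 'M[F]_3} :=
  [set P in pg_points | P *m l == 0].

Definition pg_lines : {set {set 'M[F]_3}} :=
  [set line_of l | l : 'cV[F]_3 & l != 0].

Definition line_inf : {set 'M[F]_3} :=
  line_of (\col_(i < 3) nth 0 [:: 0; 0; 1] i).

Definition affine_part (A : {set 'M[F]_3}) : {set 'M[F]_3} := A :\: line_inf.

(* Irreducibility is absolute: over F alone, a pair of conjugate lines of a
   quadratic extension would also count as irreducible. *)
Definition absolutely_irreducible (Q : {mpoly F[3]}) : Prop :=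
  [/\ Q != 0,
      Q \isn't a GRing.unit
    & forall (L : fieldType) (iota : {rmorphism F -> L})
             (Q1 Q2 : {mpoly L[3]}),
        map_mpoly iota Q = Q1 * Q2 ->
        Q1 \is a GRing.unit \/ Q2 \is a GRing.unit].

Definition zero_locus (Q : {mpoly F[3]}) : {set 'M[F]_3} :=
  [set <<v>>%MS | v : 'rV[F]_3 & (v != 0) && (Q.@[fun i => v 0 i] == 0)].

Definition is_conic (K : {set 'M[F]_3}) : Prop :=
  exists Q : {mpoly F[3]},
    [/\ Q \is 2.-homog, absolutely_irreducible Q & K = zero_locus Q].

Definition is_ellipse (K : {set 'M[F]_3}) : Prop :=
  is_conic K /\ #|K :&: line_inf| = 0%N.

Definition is_hyperbola (K : {set 'M[F]_3}) : Prop :=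
  is_conic K /\ #|K :&: line_inf| = 2%N.

(* The lines of a subplane with point set B are the intersections with B of
   the lines of the ambient plane that have at least two points in B. *)
Definition sublines (B : {set 'M[F]_3}) : {set {set 'M[F]_3}} :=
  [set l :&: B | l in pg_lines & (2 <= #|l :&: B|)%N].

Definition quadrangle (A : {set 'M[F]_3}) : bool :=
  (#|A| == 4) && [forall l in pg_lines, (#|l :&: A| <= 2)%N].

(* Two distinct points of B are joined by a unique subline automatically, so
   the remaining projective plane axioms are that any two sublines meet in B
   and that B contains a quadrangle. *)
Definition subplane_of_order (n : nat) (B : {set 'M[F]_3}) : bool :=
  [&& B \subset pg_points,
      [forall m1 in sublines B, forall m2 in sublines B, m1 :&: m2 != set0],
      [exists A : {set 'M[F]_3}, (A \subset B) && quadrangle A]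
    & [forall m in sublines B, #|m| == n.+1]].

Section Derivation.

(* q is meant to satisfy #|F| = q ^ 2. *)
Variable q : nat.

(* The subfield GF(q) of F = GF(q^2). *)
Definition GFq : {set F} := [set x | x ^+ q == x].

Definition derivation_set : {set 'M[F]_3} :=
  [set hpoint u.1 u.2 0 | u : F * F
    & [&& u.1 \in GFq, u.2 \in GFq & u != (0, 0)]].

Definition conj_image (P R : 'M[F]_3) : bool :=
  [exists u : F * F,
    [&& u != (0, 0), P == hpoint u.1 u.2 0
      & R == hpoint (u.1 ^+ q) (u.2 ^+ q) 0]].

Definition conjugate_points (P R : 'M[F]_3) : bool :=
  conj_image P R && conj_image R P.

Definition old_lines : {set {set 'M[F]_3}} :=
  [set affine_part l | l in pg_lines
    & (l != line_inf) && [disjoint l & derivation_set]].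

Definition new_lines : {set {set 'M[F]_3}} :=
  [set affine_part B | B : {set 'M[F]_3}
    & subplane_of_order q B && (derivation_set \subset B)].

Definition hall_lines : {set {set 'M[F]_3}} := old_lines :|: new_lines.

Definition hall_collinear (T : {set 'M[F]_3}) : bool :=
  [exists l in hall_lines, T \subset l].

Definition collinear_triples (A : {set 'M[F]_3}) : {set {set 'M[F]_3}} :=
  [set T : {set 'M[F]_3} | [&& T \subset A, #|T| == 3 & hall_collinear T]].

End Derivation.

End Plane.

(* Main.v *)
Require Import Defs.
From Stdlib Require Import Ring.
From mathcomp Require Import all_boot all_algebra finfield closed_field zify.
From mathcomp Require Import mpoly.

Set Implicit Arguments.
Unset Strict Implicit.
Unset Printing Implicit Defensive.

Import GRing.Theory.
Local Open Scope ring_scope.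

(** A conic with 0 or 2 points at infinity has, in characteristic two, a centre
    (its nucleus) which is an affine point off the conic.  With the origin at
    the centre, and after scaling, its affine part is N = 1, where
    N(x,y) = a x^2 + b xy + c y^2 with b <> 0, its points at infinity are the
    zeros of N, and the polar form of N is b det.  The affine parts of the Baer
    subplanes containing D are the sets w + l GF(q)^2 with l <> 0
    ([new_linesP]).  An ordinary line meets the conic in at most two points, so
    everything takes place on these sets.

    Counting.  If p and p + l u are on the conic, then l N(u) = b det(p,u).  Two
    such chords l u and l v at p determine p by Cramer's rule, and then
    N(p) = 1 reads
         l^2 N(u) N(v) N(u+v) = (b det(u,v))^2        ([triple_scale]).
    Squaring is bijective, so a collinear triple p, p + l u, p + l v is
    determined by u and v up to a common scalar, that is, by the three
    directions of u, v and u + v.  These are three distinct points of D off the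
    conic, and every such choice arises.  Sending a triple to its set of
    directions is thus a bijection onto the 3-subsets of D \ K
    ([dirset_inj], [dirset_surj], [card_baer_triples]), and D \ K has q + 1
    points in case (a), q points in case (b).

    Bounds.  Let l u and l v be two chords at p, and put
    al = N(u) / (b det(u,v)), ga = N(v) / (b det(u,v)).  A third chord in
    direction x u + y v, with x and y in GF(q), satisfies
    al (x^2 + x) + ga (y^2 + y) = xy, and also the equation with conjugate
    coefficients.  Unless al and ga lie in GF(q), two solutions in different
    directions force al + ga = 1, that is N(u+v) = 0, against [triple_scale]:
    at most three chords, hence at most four points.  If N has a zero in D,
    a single solution already leads to N(u+v) = 0: at most three points
    ([two_points], [root_and_point]).

    Finally al and ga in GF(q) would make N proportional to a form over GF(q).
    Such a form has a zero over GF(q^2), and conjugation permutes its zeros.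
    This excludes ellipses, and for a hyperbola it makes the two points at
    infinity conjugate as soon as one of them is outside D. *)

(** * Sets with two or three elements *)

Lemma card2_eq (X : finType) (S : {set X}) x y z : #|S| = 2 ->
  x \in S -> y \in S -> z \in S -> x != y -> x != z -> y = z.
Proof.
move=> cS xS yS zS xy xz; apply/eqP; apply: contra_eqT cS => yz.
have : (#|[set x; y; z]| <= #|S|)%N.
  by apply/subset_leq_card/subsetP => t; rewrite !inE -orbA => /or3P[] /eqP->.
rewrite setUC cardsU1 cards2 !inE negb_or !(eq_sym z) xz yz xy; move: #|S|; clear; lia.
Qed.

Lemma cards3P (X : finType) (A : {set X}) : #|A| = 3 ->
  exists x y z, [/\ x != y, x != z, y != z & A = [set x; y; z]].
Proof.
move=> cA; have [x xA] : exists x, x \in A by apply/card_gt0P; rewrite cA.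
have := cardsD1 x A; rewrite cA xA => -[/esym/eqP/cards2P[y [z [yz e]]]].
have: y \in A :\ x by rewrite e !inE eqxx.
have: z \in A :\ x by rewrite e !inE eqxx orbT.
rewrite !inE => /andP[zx _] /andP[yx _]; exists x, y, z.
by rewrite yz !(eq_sym x) zx yx -(setD1K xA) e setUA.
Qed.

Lemma third_of_three (X : finType) (A : {set X}) x y z w :
  A = [set x; y; z] -> A = [set x; y; w] -> z != x -> z != y -> z = w.
Proof.
move=> -> e zx zy; have : z \in [set x; y; w] by rewrite -e !inE eqxx !orbT.
by rewrite !inE (negPf zx) (negPf zy) => /eqP.
Qed.

(** * Ring identities in characteristic two *)

Section CharTwoRing.

Variable A : comNzRingType.

(** Ring structures reach their operations along several inheritance paths.
    Copies of the operations as constants give every expression a single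
    syntactic form, on which the identities can be normalised. *)
Definition c2add (x y : A) : A := x + y.
Definition c2mul (x y : A) : A := x * y.
Definition c2opp (x : A) : A := - x.
Definition c2sub (x y : A) : A := x - y.
Definition c2exp (x : A) (n : nat) : A := x ^+ n.
Definition c20 : A := 0.
Definition c21 : A := 1.
Definition c2_of_bool (b : bool) : A := if b then c21 else c20.

Lemma c2_theory : ring_theory c20 c21 c2add c2mul c2sub c2opp eq.
Proof.
split; rewrite /c20 /c21 /c2add /c2mul /c2sub /c2opp //;
  [exact: add0r | exact: addrC | exact: addrA | exact: mul1r | exact: mulrC
  | exact: mulrA | exact: mulrDl | exact: addrN].
Qed.

(** With coefficients in the field of two elements, an identity whose two sides
    differ by a multiple of 2 is decided by normalisation. *)
Lemma c2_morph : 2 = 0 :> A ->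
  ring_morph c20 c21 c2add c2mul c2sub c2opp eq
    false true xorb andb xorb id Bool.eqb c2_of_bool.
Proof.
move=> two0; have e : c2add c21 c21 = c20 by rewrite -[RHS]two0.
have o : c2opp c21 = c21.
  by apply/eqP; rewrite eq_sym -addr_eq0; apply/eqP.
split=> //; rewrite /c2_of_bool.
- by case=> -[] //=; rewrite ?e // /c2add /c20 ?addr0 ?add0r.
- by case=> -[] //=; rewrite /c2sub /c20 /c2add ?subrr ?subr0 ?sub0r.
- by case=> -[] //=; rewrite /c2mul /c20 /c21 ?mulr0 ?mul0r ?mulr1 ?mul1r.
- by case=> //=; rewrite /c2opp oppr0.
- by case=> -[].
Qed.

(** Adding zero gives both sides the type [A] on the nose. *)
Lemma c2_start (x y : A) : c2add x c20 = c2add y c20 -> x = y.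
Proof. by rewrite /c2add /c20 !addr0. Qed.

End CharTwoRing.

Ltac c2_cst t :=
  match t with
  | c20 _ => constr:(false)
  | c21 _ => constr:(true)
  | _ => constr:(InitialRing.NotConstant)
  end.

Ltac char2_ring A :=
  rewrite ?exprS ?expr0 ?mulr1 /=;
  repeat match goal with
  | |- context [@GRing.add ?V ?x ?y] =>
      change (@GRing.add V x y) with (@c2add A x y)
  | |- context [@GRing.mul ?V ?x ?y] =>
      change (@GRing.mul V x y) with (@c2mul A x y)
  | |- context [@GRing.exp ?V ?x ?n] =>
      change (@GRing.exp V x n) with (@c2exp A x n)
  | |- context [@GRing.opp ?V ?x] =>
      change (@GRing.opp V x) with (@c2opp A x)
  | |- context [@GRing.one ?V] => change (@GRing.one V) with (c21 A)
  | |- context [@GRing.zero ?V] => change (@GRing.zero V) with (c20 A)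
  end;
  apply: (@c2_start A); ring.

Section ConicFactor.

Variable A : comNzRingType.
Hypothesis two0 : 2 = 0 :> A.

Add Ring generic_c2_ring : (c2_theory A)
  (morphism (c2_morph two0), constants [c2_cst]).

(** A conic containing its centre (x0 : y0 : 1) is a pair of lines through the
    centre, one for each root of the quadratic part. *)
Lemma conic_factor_monic (X Y Z a r s x0 y0 : A) :
  a * X ^+ 2 + a * (r + s) * (X * Y) + a * r * s * Y ^+ 2 +
  a * (r + s) * y0 * (X * Z) + a * (r + s) * x0 * (Y * Z) +
  (a * x0 ^+ 2 + a * (r + s) * x0 * y0 + a * r * s * y0 ^+ 2) * Z ^+ 2 =
  a * (X + x0 * Z + r * (Y + y0 * Z)) * (X + x0 * Z + s * (Y + y0 * Z)).
Proof. by char2_ring A. Qed.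

Lemma conic_factor_deg1 (X Y Z b c x0 y0 : A) :
  b * (X * Y) + c * Y ^+ 2 + b * y0 * (X * Z) + b * x0 * (Y * Z) +
  (b * x0 * y0 + c * y0 ^+ 2) * Z ^+ 2 =
  (Y + y0 * Z) * (b * (X + x0 * Z) + c * (Y + y0 * Z)).
Proof. by char2_ring A. Qed.

End ConicFactor.

(** * Ternary quadratic forms *)

Lemma ord3 (i : 'I_3) : [\/ i = 0, i = 1 | i = 2%:R].
Proof.
case: i => [[|[|[|i]]] Hi] //; [apply: Or31 | apply: Or32 | apply: Or33];
  exact: val_inj.
Qed.

Definition quad3 (A : comNzRingType) (a b c d e f X Y Z : A) : A :=
  a * X ^+ 2 + b * (X * Y) + c * Y ^+ 2 + d * (X * Z) + e * (Y * Z) + f * Z ^+ 2.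

Lemma quad3_hom (A : comNzRingType) (a b c d e f t x y z : A) :
  quad3 a b c d e f (t * x) (t * y) (t * z) = t ^+ 2 * quad3 a b c d e f x y z.
Proof.
have E (k0 u v : A) : k0 * (t * u * (t * v)) = t ^+ 2 * (k0 * (u * v)).
  by rewrite expr2 [t * u * _]mulrACA [LHS]mulrCA.
by rewrite /quad3 !expr2 !E -expr2 !mulrDr.
Qed.

Lemma mpoly_sum_uniq (R : comNzRingType) n (p : {mpoly R[n]}) (s : seq 'X_{1..n}) :
  uniq s -> {subset msupp p <= s} ->
  p = \sum_(m <- s) (p@_m)%:MP * 'X_[m].
Proof.
move=> us sp; apply/mpolyP => m; rewrite raddf_sum /=.
case: (boolP (m \in s)) => ms.
  rewrite (bigD1_seq m) //= mcoeffCM mcoeffX eqxx mulr1 big1 ?addr0 // => i im.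
  by rewrite mcoeffCM mcoeffX (negPf im) mulr0.
rewrite big1_seq => [|i /andP[_ iS]].
  by apply: memN_msupp_eq0; apply: contra ms; exact: sp.
rewrite mcoeffCM mcoeffX (_ : (i == m) = false) ?mulr0 //.
by apply: contraNF ms => /eqP<-.
Qed.

(** The six monomials of degree two are enumerated by their exponents. *)
Lemma quad3P (R : comNzRingType) (Q : {mpoly R[3]}) : Q \is 2.-homog ->
  exists a b c d e f : R,
    Q = quad3 a%:MP b%:MP c%:MP d%:MP e%:MP f%:MP 'X_0 'X_1 'X_(2%:R).
Proof.
move=> /dhomogP hQ.
pose u0 := mnm1 (0 : 'I_3); pose u1 := mnm1 (1 : 'I_3).
pose u2 := mnm1 (2%:R : 'I_3).
pose s : seq 'X_{1..3} := [:: (u0 + u0); (u0 + u1); (u1 + u1);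
  (u0 + u2); (u1 + u2); (u2 + u2)]%MM.
have mE (m m' : 'X_{1..3}) :
    (m == m') = [&& m 0 == m' 0, m 1 == m' 1 & m 2%:R == m' 2%:R].
  apply/eqP/and3P => [->|[/eqP e0 /eqP e1 /eqP e2]]; first by rewrite !eqxx.
  by apply/mnmP => i; case: (ord3 i) => ->.
have us : uniq s.
  by rewrite /= !inE !mE !mnmDE !mnm1E.
have sub : {subset msupp Q <= s}.
  move=> m /hQ; rewrite /= mdegE !big_ord_recl big_ord0 addn0.
  rewrite !inE !mE !mnmDE !mnm1E /=.
  rewrite (_ : lift _ _ = 1); last exact: val_inj.
  rewrite (_ : lift _ _ = 2%:R); last exact: val_inj.
  by move: (m 0) (m 1) (m 2%:R) => [|[|[|x]]] [|[|[|y]]] [|[|[|z]]] //=; lia.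
rewrite (mpoly_sum_uniq us sub) !big_cons big_nil addr0 !mpolyXD.
exists Q@_(u0 + u0)%MM, Q@_(u0 + u1)%MM, Q@_(u1 + u1)%MM,
  Q@_(u0 + u2)%MM, Q@_(u1 + u2)%MM, Q@_(u2 + u2)%MM.
by rewrite /quad3 !expr2 -!addrA.
Qed.

Lemma mpoly_unitP (R : fieldType) n (p : {mpoly R[n]}) : p \is a GRing.unit ->
  forall v, p.@[v] != 0.
Proof. by move=> pu v; rewrite -unitfE; exact: (rmorph_unit (meval v)). Qed.

Lemma closed_roots (K : closedFieldType) (b c : K) : exists r s, r + s = b /\ r * s = c.
Proof.
have [r er] := @solve_monicpoly K 2%N (nth 0 [:: - c; b]) isT.
exists r, (b - r); split; first by rewrite addrC subrK.
move: er; rewrite !big_ord_recl big_ord0 /= expr0 expr1 mulr1 addr0.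
rewrite mulrBr -expr2 => ->.
by rewrite opprD opprK addrA [r * b]mulrC addrAC subrr add0r.
Qed.

(** If the centre (x0 : y0 : 1) were on the conic, the form would reduce to its
    quadratic part in X + x0 Z and Y + y0 Z, and so split into two linear factors
    over an algebraic closure. *)
Lemma centre_off_conic (F : finFieldType) (two0 : 2 = 0 :> F) (a b c x0 y0 f : F) :
  absolutely_irreducible (quad3 a%:MP b%:MP c%:MP (b * y0)%:MP (b * x0)%:MP f%:MP
    'X_0 'X_1 'X_(2%:R)) ->
  a * x0 ^+ 2 + b * x0 * y0 + c * y0 ^+ 2 + f != 0.
Proof.
move=> [_ _ irr]; apply/eqP => /eqP; rewrite addrC addr_eq0 => /eqP ef.
have ef' : f = a * x0 ^+ 2 + b * x0 * y0 + c * y0 ^+ 2.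
  rewrite ef -[LHS]addr0 -[X in _ + X](mulr0 (a * x0 ^+ 2 + b * x0 * y0 + c * y0 ^+ 2)).
  by rewrite -two0 mulr_natr mulr2n addrA addNr add0r.
have [L [io _]] := countable_algebraic_closure F.
have two0L : 2 = 0 :> {mpoly L[3]}.
  have : 2 = 0 :> L by rewrite -(rmorph_nat io) two0 rmorph0.
  by move=> e; rewrite -(rmorph_nat (@mpolyC 3 L)) e rmorph0.
have /= := irr L io.
rewrite /quad3 !(rmorphD, rmorphXn, rmorphM) /= !map_mpolyC !map_mpolyX /=.
have nu (p : {mpoly L[3]}) : p.@[fun=> 0] = 0 -> p \isn't a GRing.unit.
  by move=> p0; apply/negP => /mpoly_unitP/(_ (fun=> 0)); rewrite p0 eqxx.
have ev0 := (mevalM, mevalD, mevalXU, mevalC, mulr0, addr0).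
(* If a = 0, one of the two lines is Y + y0 Z = 0 and no root is needed. *)
case: (eqVneq a 0) ef' => [-> | a0] -> {ef}.
  rewrite (rmorph0 io) mpolyC0 !mul0r !add0r !(rmorphD, rmorphXn, rmorphM) /=.
  rewrite conic_factor_deg1 // => /(_ _ _ erefl) [] /negPn; apply/negP; rewrite negbK;
  by apply: nu; rewrite !ev0.
have [r [s [rs1 rs2]]] := closed_roots (io (b / a)) (io (c / a)).
have eb : io b = io a * (r + s) by rewrite rs1 -rmorphM mulrC divfK.
have ec : io c = io a * r * s by rewrite -mulrA rs2 -rmorphM mulrC divfK.
rewrite !(rmorphD, rmorphXn, rmorphM) /= eb ec !(rmorphD, rmorphXn, rmorphM) /=.
rewrite conic_factor_monic // => /(_ _ _ erefl) [] /negPn; apply/negP; rewrite negbK;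
by apply: nu; rewrite !ev0.
Qed.

(** * Fields of order q^2, q a power of two *)

Section HallPlane.

Variables (F : finFieldType) (q h : nat).
Hypotheses (hq2 : q = (2 ^ h)%N) (hq4 : (4 <= q)%N) (hF : #|F| = (q ^ 2)%N).

Lemma two_eq0 : 2 = 0 :> F.
Proof.
have h_gt0 : (0 < h)%N by case: h hq2 hq4 => // ->.
have e : #|F| = (2 ^ (h * 2))%N by rewrite hF hq2 expnM.
have /(card_finPcharP e) : prime 2 by [].
by move=> /andP[_ /eqP].
Qed.

Let Fr : comNzRingType := F.
Add Ring f2_ring : (c2_theory Fr) (morphism (c2_morph two_eq0), constants [c2_cst]).
Ltac ring2 := char2_ring Fr.

Lemma addrr2 (x : F) : x + x = 0. Proof. by ring2. Qed.

Lemma addr_eq02 (x y : F) : (x + y == 0) = (x == y).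
Proof. by rewrite addr_eq0 (_ : - y = y) //; ring2. Qed.

(** In characteristic two [x = y] amounts to [x + y = 0], and it is enough to
    write [x + y] as a linear combination of known equations. *)
Lemma lincomb1 (x y c l r : F) : l = r -> x + y = c * (l + r) -> x = y.
Proof. by move=> -> /eqP; rewrite addrr2 mulr0 addr_eq02 => /eqP. Qed.

Lemma lincomb2 (x y c l r c' l' r' : F) : l = r -> l' = r' ->
  x + y = c * (l + r) + c' * (l' + r') -> x = y.
Proof. by move=> -> -> /eqP; rewrite !addrr2 !mulr0 addr0 addr_eq02 => /eqP. Qed.

Local Notation k := (GFq F q).

Lemma conjD (x y : F) : (x + y) ^+ q = x ^+ q + y ^+ q.
Proof.
rewrite hq2; elim: (h) => // n IHn.
by rewrite expnSr !exprM IHn; ring2.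
Qed.

Lemma conjK (x : F) : x ^+ q ^+ q = x.
Proof. by rewrite -exprM mulnn -hF expf_card. Qed.

Lemma conj0 : 0 ^+ q = 0 :> F.
Proof. by rewrite expr0n; case: q hq4. Qed.

Lemma inGFq x : (x \in k) = (x ^+ q == x). Proof. by rewrite inE. Qed.

Lemma GFqE x : x \in k -> x ^+ q = x. Proof. by rewrite inGFq => /eqP. Qed.

Lemma GFq0 : 0 \in k. Proof. by rewrite inGFq conj0. Qed.

Lemma GFq1 : 1 \in k. Proof. by rewrite inGFq expr1n. Qed.

Lemma GFqD x y : x \in k -> y \in k -> x + y \in k.
Proof. by rewrite !inGFq conjD => /eqP-> /eqP->. Qed.

Lemma GFqM x y : x \in k -> y \in k -> x * y \in k.
Proof. by rewrite !inGFq exprMn => /eqP-> /eqP->. Qed.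

Lemma GFqV x : x \in k -> x^-1 \in k.
Proof. by rewrite !inGFq exprVn => /eqP->. Qed.

Lemma GFqdiv x y : x \in k -> y \in k -> x / y \in k.
Proof. by move=> kx ky; apply: GFqM => //; apply: GFqV. Qed.

Lemma sqrt_exists (x : F) : exists y, y ^+ 2 = x.
Proof.
have inj : injective (fun y : F => y ^+ 2).
  move=> y z e; apply/eqP; rewrite -addr_eq02 -sqrf_eq0; apply/eqP.
  by apply: (lincomb1 (c := 1) e); ring2.
by exists (invF inj x); rewrite (f_invF inj).
Qed.

Lemma trace_GFq (x : F) : x + x ^+ q \in k.
Proof. by rewrite inGFq conjD conjK addrC. Qed.

(** The fibres of the trace onto GF(q) give the order of GF(q), the surjectivity of
    the trace, and the solvability of Artin-Schreier equations. *)
Definition trace_fiber (c : F) : {set F} := [set x | x + x ^+ q == c].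

Lemma card_trace_fiber_le c : (#|trace_fiber c| <= q)%N.
Proof.
(* x^q + x = c has at most q solutions, as roots of this polynomial. *)
pose P : {poly F} := 'X^q + ('X - c%:P).
have sP : size P = q.+1.
  by rewrite /P size_polyDl size_polyXn // size_XsubC; lia.
have nzP : P != 0 by rewrite -size_poly_eq0 sP.
rewrite -ltnS -sP cardE; apply: max_poly_roots => //; last exact: enum_uniq.
apply/allP => x; rewrite mem_enum inE => /eqP e.
by rewrite /root !hornerE -e; apply/eqP; ring2.
Qed.

Lemma trace_fiber0 : trace_fiber 0 = k.
Proof. by apply/setP => x; rewrite !inE addr_eq02 eq_sym. Qed.

Lemma sum_trace_fibers : (\sum_(c in k) #|trace_fiber c| = q ^ 2)%N.
Proof.
rewrite -hF -[RHS]sum1_card.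
rewrite [RHS](partition_big (fun x : F => x + x ^+ q) (mem k)) /=; last first.
  by move=> x _; exact: trace_GFq.
apply: eq_bigr => c _; rewrite -sum1_card; apply: eq_bigl => x.
by rewrite inE.
Qed.

(** The q^2 field elements are distributed over the fibres of the trace, each of
    which has at most q elements. *)
Lemma card_GFq : #|k| = q.
Proof.
apply/eqP; rewrite eqn_leq -{1}trace_fiber0 card_trace_fiber_le /=.
have : (q ^ 2 <= #|k| * q)%N.
  rewrite -sum_trace_fibers -sum_nat_const; apply: leq_sum => c _.
  exact: card_trace_fiber_le.
by rewrite expnS expn1 leq_mul2r; case: (q) hq4.
Qed.

Lemma card_GFqD1 c : c \in k -> #|[pred i in k | i != c]| = q.-1.
Proof.
move=> kc; have := cardD1 c (mem k); rewrite card_GFq kc /= => e.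
rewrite [q in RHS]e.
by apply: eq_card => x; rewrite !inE andbC.
Qed.

Lemma card_trace_fiber c : c \in k -> #|trace_fiber c| = q.
Proof.
move=> kc; apply/eqP; rewrite eqn_leq card_trace_fiber_le /=.
have := sum_trace_fibers; rewrite (bigD1 c) //= => e.
have : (\sum_(i in k | i != c) #|trace_fiber i| <= q.-1 * q)%N.
  apply: leq_trans (_ : \sum_(i in k | i != c) q <= _)%N.
    by apply: leq_sum => i _; exact: card_trace_fiber_le.
  by rewrite sum_nat_const (card_GFqD1 kc).
have : (q <= q ^ 2)%N by rewrite -mulnn leq_pmulr //; lia.
rewrite -subn1 mulnBl mul1n mulnn -e.
by move: #|_| (\sum_(i in k | i != c) _)%N; clear; lia.
Qed.

(** The x with x^2 + x in GF(q) are those of trace 0 or 1.  There are 2q of them,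
    and x^2 + x takes each of the q values in GF(q) at most twice. *)
Lemma artin_schreier c : c \in k -> exists x : F, x ^+ 2 + x = c.
Proof.
pose A := trace_fiber 0 :|: trace_fiber 1.
pose W (x : F) : F := x ^+ 2 + x.
have cA : #|A| = (2 * q)%N.
  rewrite /A cardsU !card_trace_fiber ?GFq0 ?GFq1 //.
  rewrite (_ : _ :&: _ = set0) ?cards0; first by lia.
  apply/setP => x; rewrite !inE; apply/negP => /andP[/eqP-> ].
  by rewrite eq_sym oner_eq0.
have WA x : x \in A -> W x \in k.
  rewrite !inE => /orP[] /eqP e.
    have e' : x ^+ q = x by apply: (lincomb1 (c := 1) e); ring2.
    by rewrite /W conjD exprAC e'.
  have e' : x ^+ q = x + 1 by apply: (lincomb1 (c := 1) e); ring2.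
  by rewrite /W conjD exprAC e'; apply/eqP; ring2.
have fib d : (#|[set x in A | W x == d]| <= 2)%N.
  case: (set_0Vmem [set x in A | W x == d]) => [->|[y]]; first by rewrite cards0.
  rewrite !inE => /andP[_ /eqP Wy].
  apply: leq_trans (_ : #|[set y; (y + 1)%R]| <= _)%N; last first.
    by rewrite cards2; case: eqP.
  apply/subset_leq_card/subsetP => x; rewrite !inE => /andP[_ /eqP Wx].
  have : (x + y) * (x + (y + 1)) = 0.
    by apply: (lincomb2 (c := 1) (c' := 1) Wx Wy); rewrite /W; ring2.
  by move/eqP; rewrite mulf_eq0 !addr_eq02.
move=> kc; case: (set_0Vmem [set x in A | W x == c]); last first.
  by case=> x; rewrite inE => /andP[_ /eqP]; exists x.
move=> e0; exfalso.
have : (\sum_(d in k) #|[set x in A | W x == d]| = 2 * q)%N.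
  rewrite -cA -[RHS]sum1_card [RHS](partition_big W (mem k)) //=.
  by apply: eq_bigr => d _; rewrite -sum1_card; apply: eq_bigl => x; rewrite inE.
rewrite (bigD1 c) //= e0 cards0 => e.
have : (\sum_(i in k | i != c) #|[set x in A | W x == i]| <= q.-1 * 2)%N.
  apply: leq_trans (_ : \sum_(i in k | i != c) 2 <= _)%N; first exact: leq_sum.
  by rewrite sum_nat_const (card_GFqD1 kc).
by move: e; rewrite add0n => ->; move: hq4; clear; lia.
Qed.

(** * The affine plane *)

(** Minus signs are left out, as the characteristic is two. *)
Definition det (u v : F * F) : F := u.1 * v.2 + u.2 * v.1.
Definition step (p : F * F) (l : F) (u : F * F) : F * F :=
  (p.1 + l * u.1, p.2 + l * u.2).
Definition GFqvec : {set F * F} := setX k k.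
(** For l <> 0, the affine part p + l GF(q)^2 of a Baer subplane containing D. *)
Definition baer_line (p : F * F) (l : F) : {set F * F} :=
  [set step p l u | u in GFqvec].

Lemma det_GFqvec u v : u \in GFqvec -> v \in GFqvec -> det u v \in k.
Proof.
by case: u v => [u1 u2] [v1 v2] /setXP[? ?] /setXP[? ?]; apply: GFqD; apply: GFqM.
Qed.

Lemma detC u v : det u v = det v u. Proof. rewrite /det; ring2. Qed.

Lemma detuu u : det u u = 0. Proof. rewrite /det; ring2. Qed.

Lemma pairE (u v : F * F) : u.1 = v.1 -> u.2 = v.2 -> u = v.
Proof. by case: u v => [u1 u2] [v1 v2] /= -> ->. Qed.

Lemma det0P u v : u != (0, 0) -> det u v = 0 -> exists t, v = step (0,0) t u.
Proof.
case: u v => [u1 u2] [v1 v2]; rewrite xpair_eqE negb_and /det /step /= => /orP[] nz e.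
  exists (v1 / u1); congr pair; rewrite add0r; first by rewrite divfK.
  apply: (mulfI nz); rewrite mulrA [u1 * (v1 / u1)]mulrC divfK //.
  by apply: (lincomb1 (c := 1) e); ring2.
exists (v2 / u2); congr pair; rewrite add0r; last by rewrite divfK.
apply: (mulfI nz); rewrite mulrA [u2 * (v2 / u2)]mulrC divfK //.
by apply: (lincomb1 (c := 1) e); ring2.
Qed.

Lemma cramer u v w : det u v != 0 ->
  w = step (step (0, 0) (det w v / det u v) u) (det u w / det u v) v.
Proof.
have aux x y z : det u v * z = x + y -> det u v != 0 ->
    z = x / det u v + y / det u v.
  by move=> e nz; rewrite -mulrDl -e mulrAC mulfV // mul1r.
move=> nz; apply: pairE; rewrite /step /= add0r ![_ / _ * _]mulrAC;
  by apply: aux => //; rewrite /det; ring2.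
Qed.

(** Sum and difference agree in characteristic two: [vec p r] is the vector from
    p to r. *)
Definition vec (p r : F * F) : F * F := (p.1 + r.1, p.2 + r.2).

Lemma vec_step p l u : vec p (step p l u) = step (0, 0) l u.
Proof. by apply: pairE; rewrite /vec /step /=; ring2. Qed.

Lemma vec_step2 p l u v : vec (step p l u) (step p l v) = step (0, 0) l (vec u v).
Proof. by apply: pairE; rewrite /vec /step /=; ring2. Qed.

Lemma vec_stepE p r m d : vec p r = step (0, 0) m d -> r = step p m d.
Proof.
move=> em; have [e1 e2] : (vec p r).1 = m * d.1 /\ (vec p r).2 = m * d.2.
  by rewrite em /step /= !add0r.
by apply: pairE; [apply: (lincomb1 (c := 1) e1) | apply: (lincomb1 (c := 1) e2)];
  rewrite /vec /step /=; ring2.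
Qed.

Lemma vecC p r : vec p r = vec r p.
Proof. by rewrite /vec !(addrC p.1) !(addrC p.2). Qed.

Lemma vec_eq0 p r : (vec p r == (0, 0)) = (p == r).
Proof. by case: p r => [x y] [z t]; rewrite !xpair_eqE /= !addr_eq02. Qed.

Lemma step1_vec u v : step u 1 v = vec u v.
Proof. by rewrite /step /vec !mul1r. Qed.

Lemma step_inj p l : l != 0 -> injective (step p l).
Proof. by move=> l0 u v [] /addrI/(mulfI l0) e1 /addrI/(mulfI l0) e2; exact: pairE. Qed.

Lemma step0r p l : step p l (0, 0) = p.
Proof. by case: p => x y; rewrite /step /= !mulr0 !addr0. Qed.

Lemma vec_GFqvec u v : u \in GFqvec -> v \in GFqvec -> vec u v \in GFqvec.
Proof.
by case: u v => [x y] [z t] /setXP[? ?] /setXP[? ?]; rewrite in_setX /= !GFqD.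
Qed.

Lemma GFqvec_step u s : u \in GFqvec -> s \in k -> step (0, 0) s u \in GFqvec.
Proof. by case: u => x y /setXP[? ?] ks; rewrite in_setX /step /= !add0r !GFqM. Qed.

(** * Directions defined over GF(q) *)

(** The representative of a direction whose first nonzero coordinate is 1, so
    that directions can be compared by equality. *)
Definition norm (u : F * F) : F * F := if u.1 != 0 then (1, u.2 / u.1) else (0, 1).

Lemma normE u : u != (0, 0) -> exists2 t, t != 0 & norm u = step (0, 0) t u.
Proof.
case: u => [x y] nz; rewrite /norm /step /=; case: (eqVneq x 0) => [x0|x0] /=.
  have y0 : y != 0 by apply: contra_neq nz => ->; rewrite x0.
  by exists y^-1; rewrite ?invr_eq0 // x0 mulr0 mulVf ?addr0 ?add0r.
by exists x^-1; rewrite ?invr_eq0 // !add0r mulVf // mulrC.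
Qed.

Lemma norm_scale t u : t != 0 -> norm (step (0, 0) t u) = norm u.
Proof.
move=> t0; rewrite /norm /step /= !add0r mulf_eq0 (negPf t0) /=.
by case: eqP => //= _; rewrite -mulf_div divff // mul1r.
Qed.

Lemma norm_det u v : u != (0, 0) -> v != (0, 0) -> norm u = norm v -> det u v = 0.
Proof.
move=> u0 v0; case: (normE u0) (normE v0) => s s0 -> [t t0 ->] e.
apply: (mulfI s0); apply: (mulfI t0).
have := detuu (step (0, 0) s u); rewrite {2}e !mulr0 => <-.
by rewrite /det /step /=; ring2.
Qed.

Definition dirs : {set F * F} := (0, 1) |: [set (1, t) | t in k].

Lemma card_dirs : #|dirs| = q.+1.
Proof.
rewrite cardsU1 card_imset ?card_GFq; last by move=> x y [].
rewrite (_ : _ \notin _) //; apply/imsetP => -[t _ [] /eqP].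
by rewrite eq_sym oner_eq0.
Qed.

Lemma norm_dirs u : u \in GFqvec -> u != (0, 0) -> norm u \in dirs.
Proof.
case: u => [x y] /setXP[kx ky] _; rewrite /norm /=; case: eqP => _ /=.
  by rewrite !inE eqxx.
by apply/setU1P; right; apply/imsetP; exists (y / x); rewrite ?GFqdiv.
Qed.

Lemma norm_id d : d \in dirs -> norm d = d.
Proof.
case/setU1P => [->|/imsetP[t _ ->]]; rewrite /norm /= ?eqxx ?oner_neq0 //=.
by rewrite divr1.
Qed.

Lemma dirs_GFqvec d : d \in dirs -> d \in GFqvec.
Proof. by case/setU1P => [->|/imsetP[t kt ->]]; rewrite in_setX /= ?GFq0 ?GFq1. Qed.

Lemma dirs_neq0 d : d \in dirs -> d != (0, 0).
Proof.
by case/setU1P => [->|/imsetP[t kt ->]]; rewrite xpair_eqE ?oner_eq0 ?andbF.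
Qed.

Lemma dirs10 : (1, 0) \in dirs.
Proof. by apply/setU1P; right; apply/imsetP; exists 0; rewrite ?GFq0. Qed.

Lemma dirs01 : (0, 1) \in dirs.
Proof. by rewrite !inE eqxx. Qed.

(** One coordinate of [d] is 1, so the factor is a coordinate of [u]. *)
Lemma GFqvec_par d u : d \in dirs -> u \in GFqvec -> det u d = 0 ->
  exists2 t, t \in k & u = step (0, 0) t d.
Proof.
move=> dd ku; rewrite detC => /(det0P (dirs_neq0 dd))[t et]; exists t => //.
case/setU1P: dd et => [-> | /imsetP[s _ ->]] et; move: ku; rewrite et in_setX.
  by rewrite /step /= mulr1 !add0r => /andP[].
by rewrite /step /= mulr1 !add0r => /andP[].
Qed.

(** On directions, this is conjugation with respect to D. *)
Definition conjv (u : F * F) : F * F := (u.1 ^+ q, u.2 ^+ q).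

Lemma conjv_neq0 u : u != (0, 0) -> conjv u != (0, 0).
Proof.
apply: contra_neq => e; apply: pairE => /=; apply/eqP.
  by have /eqP := congr1 fst e; rewrite /= expf_eq0 => /andP[].
by have /eqP := congr1 snd e; rewrite /= expf_eq0 => /andP[].
Qed.

Lemma conjvK u : conjv (conjv u) = u.
Proof. by apply: pairE; rewrite /= conjK. Qed.

Lemma dirs_conjv d : d \in dirs -> conjv d = d.
Proof.
move/dirs_GFqvec; case: d => x y /setXP[kx ky].
by apply: pairE; rewrite /= GFqE.
Qed.

(** * Conics with centre at the origin *)

Section Form.
Variables a b c : F.
Hypothesis b_neq0 : b != 0.

Definition N (u : F * F) : F := a * u.1 ^+ 2 + b * u.1 * u.2 + c * u.2 ^+ 2.

Lemma N_step p l u : N (step p l u) = N p + l * (b * det p u + l * N u).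
Proof. by rewrite /N /det /step; ring2. Qed.

Lemma N_step0 t u : N (step (0, 0) t u) = t ^+ 2 * N u.
Proof. by rewrite /N /step; ring2. Qed.

Lemma N_comb s u t v : N (step (step (0, 0) s u) t v) =
  s ^+ 2 * N u + s * t * (b * det u v) + t ^+ 2 * N v.
Proof. by rewrite /N /det /step; ring2. Qed.

Lemma chordE p l u : l != 0 -> N p = 1 -> N (step p l u) = 1 ->
  l * N u = b * det p u.
Proof.
move=> l0 p1; rewrite N_step p1 => e.
have /eqP : l * (b * det p u + l * N u) = 0 by apply: (lincomb1 (c := 1) e); ring2.
by rewrite mulf_eq0 (negPf l0) addr_eq02 /= => /eqP.
Qed.

(** Cramer's rule for the two equations, which are linear in p. *)
Lemma triple_apex p l u v :
  l * N u = b * det p u -> l * N v = b * det p v ->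
  step (0, 0) (b * det u v) p = step (step (0, 0) (l * N v) u) (l * N u) v.
Proof.
by move=> -> ->; apply: pairE; rewrite /step /det /=; ring2.
Qed.

(** Apply [N] to both sides of [triple_apex].  This single relation determines the
    scale of a collinear triple by its directions, and shows that these three
    directions are not zeros of [N]. *)
Lemma triple_scale p l u v : N p = 1 ->
  l * N u = b * det p u -> l * N v = b * det p v ->
  l ^+ 2 * (N u * N v * N (step u 1 v)) = (b * det u v) ^+ 2.
Proof.
move=> p1 eu ev; have := congr1 N (triple_apex eu ev).
rewrite N_step0 N_comb p1 mulr1 => ->.
by rewrite N_step; move: (N u) (N v) (det u v) => x y z; ring2.
Qed.

(** If y = t x, comparing the chord equations of x and y gives t = 1 or
    N(x) = 0; in the latter case p is a multiple of x, against N(p) = 1. *)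
Lemma no_three p x y : N p = 1 -> N (step p 1 x) = 1 -> N (step p 1 y) = 1 ->
  x != (0, 0) -> y != (0, 0) -> det x y = 0 -> x = y.
Proof.
move=> p1 Nx Ny x0 y0 /(det0P x0)[t ey].
have ex := chordE (oner_neq0 _) p1 Nx; have := chordE (oner_neq0 _) p1 Ny.
have -> : det p y = t * det p x by rewrite ey /det /step /=; ring2.
have -> : N y = t ^+ 2 * N x by rewrite ey N_step0.
have t0 : t != 0.
  by apply: contra_neq y0 => t0; rewrite ey t0 /step !mul0r !addr0.
rewrite [b * _]mulrCA -ex => /eqP; rewrite -subr_eq0 => e.
have {e} : t * (t + 1) * N x == 0.
  by rewrite -(eqP e); apply/eqP; move: (N x) => z; ring2.
rewrite !mulf_eq0 (negPf t0) addr_eq02 /= => /orP[/eqP t1|/eqP Nx0].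
  by rewrite ey t1 /step !mul1r !add0r; case: (x).
move: ex; rewrite Nx0 mulr0 => /esym/eqP; rewrite mulf_eq0 (negPf b_neq0) /=.
rewrite detC => /eqP/(det0P x0)[s ep]; move: p1.
by rewrite ep N_step0 Nx0 mulr0 => /eqP; rewrite eq_sym oner_eq0.
Qed.

(** * Forms defined over GF(q) *)

(** [N] is proportional to a form with coefficients in GF(q). *)
Definition rational : bool := (a / b \in k) && (c / b \in k).

(** Evaluating [N] in the basis u, v of GF(q)^2 recovers its coefficients up to b. *)
Lemma rationalP u v : u \in GFqvec -> v \in GFqvec -> det u v != 0 ->
  N u / (b * det u v) \in k -> N v / (b * det u v) \in k -> rational.
Proof.
move=> ku kv nz.
have kd := det_GFqvec ku kv.
have red x : N x / (b * det u v) \in k -> N x / b \in k.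
  by move=> /GFqM/(_ kd); rewrite invfM mulrA divfK.
move=> /red ru /red rv.
have aux s t x y d : (s ^+ 2 * x + s * t * (b * d) + t ^+ 2 * y) / b =
    s * s * (x / b) + s * t * d + t * t * (y / b).
  by rewrite !mulrDl !expr2 !mulrA [s * t * b * d]mulrAC mulfK.
have main w : w \in GFqvec -> N w / b \in k.
  move=> kw; rewrite (cramer w nz) N_comb.
  have kx : det w v / det u v \in k by rewrite GFqdiv ?det_GFqvec.
  have ky : det u w / det u v \in k by rewrite GFqdiv ?det_GFqvec.
  by rewrite aux; apply: GFqD; [apply: GFqD|]; apply: GFqM => //; apply: GFqM.
apply/andP; split.
  have := main (1, 0); rewrite in_setX GFq1 GFq0 /N /= => /(_ isT).
  by rewrite !expr0n !mulr0 expr1n mulr1 !addr0.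
have := main (0, 1); rewrite in_setX GFq1 GFq0 /N /= => /(_ isT).
by rewrite !expr0n !mulr0 mul0r expr1n mulr1 !add0r.
Qed.

Lemma N_monic x : N x = b * (a / b * x.1 ^+ 2 + x.1 * x.2 + c / b * x.2 ^+ 2).
Proof.
transitivity (b * (a / b) * x.1 ^+ 2 + b * x.1 * x.2 + b * (c / b) * x.2 ^+ 2).
  by rewrite ![b * (_ / _)]mulrC !divfK.
by move: (a / b) (c / b) => al ga; ring2.
Qed.

(** Over GF(q) an irreducible quadratic splits in GF(q^2); in characteristic two
    it is an Artin-Schreier equation. *)
Lemma rational_root : rational -> exists2 u, u != (0, 0) & N u = 0.
Proof.
case/andP=> ka kc; case: (eqVneq (a / b) 0) => [a0|a0].
  exists (1, 0); first by rewrite xpair_eqE oner_eq0.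
  by rewrite N_monic a0 /=; ring2.
have [x ex] := artin_schreier (GFqM ka kc).
exists (x / (a / b), 1); first by rewrite xpair_eqE oner_eq0 andbF.
rewrite N_monic /=; move: (a / b) (c / b) a0 ex => al ga al0 ex.
apply: (mulfI al0); have f : al * (x / al) = x by rewrite mulrC divfK.
transitivity (b * ((al * (x / al)) ^+ 2 + al * (x / al) + al * ga)).
  by move: (x / al) => y; ring2.
by rewrite f ex addrr2 !mulr0.
Qed.

Lemma rational_conj u : rational -> N u = 0 -> N (conjv u) = 0.
Proof.
case/andP=> ka kc.
rewrite !N_monic /=; move: (a / b) (c / b) ka kc => al ga ka kc /eqP.
rewrite mulf_eq0 (negPf b_neq0) /= => /eqP/(congr1 (fun z : F => z ^+ q)).
rewrite !(conjD, exprMn) (GFqE ka) (GFqE kc) conj0 => e.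
by rewrite !expr2 e mulr0.
Qed.

(** * Intersecting the conic with its conjugate *)

Section Coordinates.
Variables (al ga : F).

(** The minors of the 2 x 3 system al X + ga Y = Z, al^q X + ga^q Y = Z. *)
Definition dal := al + al ^+ q.
Definition dga := ga + ga ^+ q.
Definition dlt := al * ga ^+ q + al ^+ q * ga.

(** Eliminate y^2 + y, respectively x^2 + x, between the equation and its
    conjugate, and cancel x, respectively y. *)
Lemma conic_coord x y : x \in k -> y \in k -> x != 0 -> y != 0 ->
  al * (x ^+ 2 + x) + ga * (y ^+ 2 + y) = x * y ->
  dlt * (x + 1) = dga * y /\ dlt * (y + 1) = dal * x.
Proof.
move=> kx ky x0 y0 e.
have e' : al ^+ q * (x ^+ 2 + x) + ga ^+ q * (y ^+ 2 + y) = x * y.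
  have := congr1 (fun z : F => z ^+ q) e; rewrite /= !(conjD, exprMn).
  by rewrite (GFqE kx) (GFqE ky) !expr2.
rewrite /dlt /dal /dga; move: (al ^+ q) (ga ^+ q) e' => A G e'; split.
  apply: (mulfI x0); apply: (lincomb2 (c := G) (c' := ga) e e'); ring2.
apply: (mulfI y0); apply: (lincomb2 (c := A) (c' := al) e e'); ring2.
Qed.

Lemma root_coord s t : s \in k -> t \in k -> s != 0 -> t != 0 ->
  al * s ^+ 2 + s * t + ga * t ^+ 2 = 0 ->
  dlt * s = dga * t /\ dlt * t = dal * s.
Proof.
move=> kx ky x0 y0 e.
have e' : al ^+ q * s ^+ 2 + s * t + ga ^+ q * t ^+ 2 = 0.
  have := congr1 (fun z : F => z ^+ q) e; rewrite /= conj0 !(conjD, exprMn).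
  by rewrite (GFqE kx) (GFqE ky) !expr2.
rewrite /dlt /dal /dga; move: (al ^+ q) (ga ^+ q) e' => A G e'; split.
  apply: (mulfI x0); apply: (lincomb2 (c := G) (c' := ga) e e'); ring2.
apply: (mulfI y0); apply: (lincomb2 (c := A) (c' := al) e e'); ring2.
Qed.

Lemma dal_eq0 : dal = 0 -> al \in k.
Proof. by move/eqP; rewrite addr_eq02 inGFq eq_sym. Qed.

Lemma dga_eq0 : dga = 0 -> ga \in k.
Proof. by move/eqP; rewrite addr_eq02 inGFq eq_sym. Qed.

(** The sum of the two relations of [conic_coord] is linear in (x,y); two
    independent solutions make its coefficients vanish, so dlt = dal = dga.  If
    this value is not 0, the identity dlt = dga al + dal ga gives al + ga = 1. *)
Lemma two_points x y z w : x \in k -> y \in k -> x != 0 -> y != 0 ->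
  z \in k -> w \in k -> z != 0 -> w != 0 -> x * w + y * z != 0 ->
  al * (x ^+ 2 + x) + ga * (y ^+ 2 + y) = x * y ->
  al * (z ^+ 2 + z) + ga * (w ^+ 2 + w) = z * w ->
  (al \in k) && (ga \in k) \/ al + ga = 1.
Proof.
move=> kx ky x0 y0 kz kw z0 w0 nz e1 e2.
have [f1 f2] := conic_coord kx ky x0 y0 e1.
have [f3 f4] := conic_coord kz kw z0 w0 e2.
have g1 : (dlt + dal) * x = (dlt + dga) * y.
  by apply: (lincomb2 (c := 1) (c' := 1) f1 f2); ring2.
have g2 : (dlt + dal) * z = (dlt + dga) * w.
  by apply: (lincomb2 (c := 1) (c' := 1) f3 f4); ring2.
have da : dlt = dal.
  by apply: (mulfI nz); apply: (lincomb2 (c := w) (c' := y) g1 g2); ring2.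
have dg : dlt = dga.
  by apply: (mulfI nz); apply: (lincomb2 (c := z) (c' := x) g1 g2); ring2.
case: (eqVneq dlt 0) => [d0|d0].
  by left; rewrite dal_eq0 ?dga_eq0 // -?da -?dg.
right; apply: (mulfI d0).
have -> : dlt * (al + ga) = dga * al + dal * ga by rewrite -da -dg; ring2.
by rewrite mulr1 /dlt /dga /dal; ring2.
Qed.

(** The root gives dga and dal as multiples of dlt.  Substitution in
    [conic_coord] gives tx + t = sy and sy + s = tx, whence s = t. *)
Lemma root_and_point x y s t : x \in k -> y \in k -> x != 0 -> y != 0 ->
  s \in k -> t \in k -> s != 0 -> t != 0 ->
  al * (x ^+ 2 + x) + ga * (y ^+ 2 + y) = x * y ->
  al * s ^+ 2 + s * t + ga * t ^+ 2 = 0 ->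
  (al \in k) && (ga \in k) \/ s = t.
Proof.
move=> kx ky x0 y0 ks kt s0 t0 e1 e2.
have [f1 f2] := conic_coord kx ky x0 y0 e1.
have [f3 f4] := root_coord ks kt s0 t0 e2.
case: (eqVneq dlt 0) => [d0|d0].
  left; rewrite dal_eq0 ?dga_eq0 //.
    by move/esym/eqP: f3; rewrite d0 mul0r mulf_eq0 (negPf t0) orbF => /eqP.
  by move/esym/eqP: f4; rewrite d0 mul0r mulf_eq0 (negPf s0) orbF => /eqP.
right; apply: (mulfI d0).
have g1 : dlt * (t * x + t) = dlt * (s * y).
  have f : dlt * (x + 1) * t = dlt * s * y by rewrite f1 f3; ring2.
  by apply: (lincomb1 (c := 1) f); ring2.
have g2 : dlt * (s * y + s) = dlt * (t * x).
  have f : dlt * (y + 1) * s = dlt * t * x by rewrite f2 f4; ring2.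
  by apply: (lincomb1 (c := 1) f); ring2.
by apply: (lincomb2 (c := 1) (c' := 1) g1 g2); ring2.
Qed.

End Coordinates.

(** * Affine Baer subplanes meeting the conic *)

Definition unit_conic : {set F * F} := [set p | N p == 1].

(** The vectors l u with u in [chords p l] join p to the other points of the
    conic on p + l GF(q)^2. *)
Definition chords p l : {set F * F} :=
  [set u in GFqvec | (u != (0, 0)) && (N (step p l u) == 1)].

Lemma chordsP p l u :
  reflect [/\ u \in GFqvec, u != (0, 0) & N (step p l u) = 1] (u \in chords p l).
Proof.
rewrite [u \in chords p l]inE; apply: (iffP idP) => [/and3P[-> -> /eqP]|[-> -> ->]] //=.
Qed.

Section Chords.
Variables (p : F * F) (l : F).
Hypotheses (l0 : l != 0) (p1 : N p = 1).

Lemma chords_N u : u \in chords p l -> l * N u = b * det p u.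
Proof. by case/chordsP => _ _; exact: chordE. Qed.

Lemma chords_det u v : u \in chords p l -> v \in chords p l ->
  u != v -> det u v != 0.
Proof.
move=> /chordsP[_ u0 Nu] /chordsP[_ v0 Nv]; apply: contra_neq => d0.
have sc x : step p l x = step p 1 (step (0, 0) l x).
  by apply: pairE; rewrite /step /=; ring2.
have nz x : x != (0, 0) -> step (0, 0) l x != (0, 0).
  apply: contra_neq; case: x => x1 x2 [] /eqP; rewrite add0r mulf_eq0 (negPf l0).
  by move=> /eqP-> /eqP; rewrite add0r mulf_eq0 (negPf l0) => /eqP->.
rewrite sc in Nu; rewrite sc in Nv.
have e : det (step (0, 0) l u) (step (0, 0) l v) = 0.
  transitivity (l ^+ 2 * det u v); last by rewrite d0 mulr0.
  by rewrite /det /step /=; ring2.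
have [] := no_three p1 Nu Nv (nz _ u0) (nz _ v0) e.
rewrite !add0r => /(mulfI l0) e1 /(mulfI l0) e2; exact: pairE.
Qed.

Lemma chords_scale u v : u \in chords p l -> v \in chords p l -> u != v ->
  [/\ N u != 0, N v != 0 & N (step u 1 v) != 0].
Proof.
move=> cu cv uv.
have := triple_scale p1 (chords_N cu) (chords_N cv).
have nz : (b * det u v) ^+ 2 != 0.
  by rewrite expf_neq0 // mulf_neq0 // chords_det.
move=> e; rewrite -e mulf_eq0 negb_or in nz; case/andP: nz => _.
by rewrite !mulf_eq0 !negb_or -andbA => /and3P[].
Qed.

(** The common factor l cancels, since the chord equation is linear in u on its
    right-hand side. *)
Lemma third_chord u v w :
  u \in chords p l -> v \in chords p l -> w \in chords p l ->
  u != v -> w != u -> w != v ->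
  exists x y, [/\ w = step (step (0, 0) x u) y v,
    x \in k /\ y \in k, x != 0 /\ y != 0 &
    N u / (b * det u v) * (x ^+ 2 + x) + N v / (b * det u v) * (y ^+ 2 + y)
      = x * y].
Proof.
move=> cu cv cw uv wu wv.
have d0 := chords_det cu cv uv.
have [ku _ _] := chordsP _ _ _ cu; have [kv _ _] := chordsP _ _ _ cv.
have [kw _ _] := chordsP _ _ _ cw.
exists (det w v / det u v), (det u w / det u v); split.
- exact: cramer.
- by rewrite !GFqdiv ?det_GFqvec.
- by rewrite !mulf_neq0 ?invr_eq0 // chords_det // eq_sym.
move: (cramer w d0); move: (det w v / _) (det u w / _) => x y ew.
have : l * N w = l * (x * N u + y * N v).
  rewrite (chords_N cw) ew; transitivity (x * (l * N u) + y * (l * N v)).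
    by rewrite (chords_N cu) (chords_N cv) /det /step /=; ring2.
  by move: (N u) (N v) => A B; ring2.
move/(mulfI l0); rewrite ew N_comb; move: (N u) (N v) => A B e.
have bd : b * det u v != 0 by rewrite mulf_neq0.
move: bd e; move: (b * det u v) => D D0 e.
have {}e : A * (x ^+ 2 + x) + B * (y ^+ 2 + y) = x * y * D.
  by apply: (lincomb1 (c := 1) e); ring2.
by rewrite !(mulrAC _ D^-1) -mulrDl e mulfK.
Qed.

(** The exceptional conclusion of [two_points] means N(u+v) = 0, which
    [chords_scale] forbids. *)
Lemma card_chords_le3 : ~~ rational -> (#|chords p l| <= 3)%N.
Proof.
move=> nr; rewrite leqNgt; apply/negP => /card_geqP[s [us ss sS]].
case: s ss us sS => [|u [|v [|w [|z [|]]]]] //= _.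
rewrite !inE !negb_or !andbT -!andbA => /and5P[uv uw uz vw /andP[vz wz]] sS.
have [cu cv cw cz] : [/\ u \in chords p l, v \in chords p l, w \in chords p l
                       & z \in chords p l].
  by split; apply: sS; rewrite !inE eqxx ?orbT.
have [||x [y [ew [kx ky] [x0 y0] exy]]] := third_chord cu cv cw uv;
  [by rewrite eq_sym..|].
have [||x' [y' [ez [kx' ky'] [x0' y0'] exy']]] := third_chord cu cv cz uv;
  [by rewrite eq_sym..|].
(* Distinct chords have independent directions. *)
have indep : x * y' + y * x' != 0.
  have := chords_det cw cz wz; rewrite ew ez; apply: contra_neq => e.
  transitivity ((x * y' + y * x') * det u v); last by rewrite e mul0r.
  by rewrite /det /step /=; ring2.
have [_ _] := chords_scale cu cv uv; apply/negP; rewrite negbK.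
have [ku _ _] := chordsP _ _ _ cu; have [kv _ _] := chordsP _ _ _ cv.
have d0 := chords_det cu cv uv.
case: (two_points kx ky x0 y0 kx' ky' x0' y0' indep exy exy').
  by case/andP=> r1 r2; case/negP: nr; exact: rationalP r1 r2.
rewrite -mulrDl => /(congr1 (fun t => t * (b * det u v))).
rewrite /= divfK ?mulf_neq0 // mul1r => e.
apply/eqP; apply: (lincomb1 (c := 1) e); rewrite N_step.
by move: (N u) (N v) => A B; ring2.
Qed.

(** By [root_and_point] the zero of [N] would be a multiple of u + v. *)
Lemma card_chords_le2 r : ~~ rational -> r \in GFqvec -> r != (0, 0) -> N r = 0 ->
  (#|chords p l| <= 2)%N.
Proof.
move=> nr kr r0 Nr; rewrite leqNgt; apply/negP => /card_geqP[S [us ss sS]].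
case: S ss us sS => [|u [|v [|w [|]]]] //= _.
rewrite !inE !negb_or !andbT -!andbA => /and3P[uv uw vw] sS.
have [cu cv cw] : [/\ u \in chords p l, v \in chords p l & w \in chords p l].
  by split; apply: sS; rewrite !inE eqxx ?orbT.
have [||x [y [ew [kx ky] [x0 y0] exy]]] := third_chord cu cv cw uv;
  [by rewrite eq_sym..|].
have d0 := chords_det cu cv uv.
have [Nu Nv Nuv] := chords_scale cu cv uv.
have [ku _ _] := chordsP _ _ _ cu; have [kv _ _] := chordsP _ _ _ cv.
have ks0 := GFqdiv (det_GFqvec kr kv) (det_GFqvec ku kv).
have kt0 := GFqdiv (det_GFqvec ku kr) (det_GFqvec ku kv).
move: (cramer r d0) ks0 kt0.
move: (det r v / _) (det u r / _) => s t er ks kt.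
have e := Nr; rewrite er N_comb in e.
have s0 : s != 0.
  apply: contraNneq r0 => s0; move/eqP: e; rewrite s0 expr0n !mul0r !add0r.
  rewrite mulf_eq0 (negPf Nv) orbF sqrf_eq0 => /eqP t0.
  by rewrite er s0 t0 /step !mul0r !addr0.
have t0 : t != 0.
  apply: contraNneq r0 => t0; move/eqP: e.
  rewrite t0 expr0n mulr0 !mul0r !addr0 mulf_eq0 (negPf Nu) orbF sqrf_eq0.
  by move=> /eqP s0'; rewrite er s0' t0 /step !mul0r !addr0.
have bd : b * det u v != 0 by rewrite mulf_neq0.
have e' : N u / (b * det u v) * s ^+ 2 + s * t + N v / (b * det u v) * t ^+ 2 = 0.
  apply: (mulIf bd); rewrite mul0r -[RHS]e.
  move: (N u) (N v) bd; move: (b * det u v) => D A B D0; rewrite !mulrDl.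
  by rewrite ![_ / D * _]mulrC -![_ ^+ 2 * _ * D]mulrA !divfK.
case: (root_and_point kx ky x0 y0 ks kt s0 t0 exy e').
  by case/andP=> r1 r2; case/negP: nr; exact: rationalP r1 r2.
move=> est; case/negP: Nuv; apply/eqP; apply: (mulfI (expf_neq0 2 s0)).
rewrite mulr0 -[RHS]Nr er -est N_comb N_step.
by move: (N u) (N v) => A B; ring2.
Qed.

End Chords.

Lemma baer_line_chord w l p r : l != 0 ->
  p \in baer_line w l :&: unit_conic -> r \in baer_line w l :&: unit_conic -> r != p ->
  exists2 u, u \in chords p l & r = step p l u.
Proof.
move=> l0 /setIP[/imsetP[u ku ep] _] /setIP[/imsetP[v kv er]].
rewrite inE => /eqP Nr rp.
have e : step p l (step u 1 v) = r.
  by rewrite er ep; apply: pairE; rewrite /step /=; ring2.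
exists (step u 1 v) => //; apply/chordsP; split.
- case: u v ku kv {e ep er} => [u1 u2] [v1 v2] /setXP[? ?] /setXP[? ?].
  by rewrite in_setX /step /= !mul1r !GFqD.
- apply: contra_neq rp; rewrite er ep /step /= !mul1r => -[/eqP e1 /eqP e2].
  by move: e1 e2; rewrite !addr_eq02 => /eqP-> /eqP->.
- by rewrite e.
Qed.

Lemma card_baer_line_conic p0 l m : l != 0 ->
  (forall p, N p = 1 -> (#|chords p l| <= m)%N) ->
  (#|baer_line p0 l :&: unit_conic| <= m.+1)%N.
Proof.
move=> l0 H; case: (set_0Vmem (baer_line p0 l :&: unit_conic)) => [->|[p pS]].
  by rewrite cards0.
have Np : N p = 1 by case/setIP: pS => _; rewrite inE => /eqP.
have : baer_line p0 l :&: unit_conic \subset p |: step p l @: chords p l.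
  apply/subsetP => r rS; case: (eqVneq r p) => [->|rp]; first by rewrite !inE eqxx.
  have [u cu ->] := baer_line_chord l0 pS rS rp.
  by apply/setU1P; right; apply: imset_f.
move/subset_leq_card/leq_trans; apply.
rewrite cardsU1; apply: leq_trans (_ : 1 + #|chords p l| <= _)%N.
  by apply: leq_add; [case: (_ \notin _) | exact: leq_imset_card].
by rewrite add1n ltnS H.
Qed.

Lemma baer_line_le4 p0 l : l != 0 -> ~~ rational ->
  (#|baer_line p0 l :&: unit_conic| <= 4)%N.
Proof.
by move=> l0 nr; apply: card_baer_line_conic => // p Np; exact: card_chords_le3.
Qed.

Lemma baer_line_le3 p0 l r : l != 0 -> ~~ rational ->
  r \in GFqvec -> r != (0, 0) -> N r = 0 -> (#|baer_line p0 l :&: unit_conic| <= 3)%N.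
Proof.
move=> l0 nr kr r0 Nr; apply: card_baer_line_conic => // p Np.
exact: card_chords_le2 nr kr r0 Nr.
Qed.

Lemma N_norm_neq0 u : u != (0, 0) -> (N (norm u) != 0) = (N u != 0).
Proof. by case/normE => t t0 ->; rewrite N_step0 mulf_eq0 sqrf_eq0 (negPf t0). Qed.

(** * Collinear triples and triples of directions *)

Definition free_dirs : {set F * F} := [set d in dirs | N d != 0].

Definition baer_triples : {set {set F * F}} :=
  [set T : {set F * F} | [&& T \subset unit_conic, #|T| == 3 &
    [exists p, exists l, (l != 0) && (T \subset baer_line p l)]]].

Definition apex_triple p l u v : {set F * F} := [set p; step p l u; step p l v].

(** A description of a triple by one of its vertices and the two chords there; up
    to scaling there are six, permuted by [is_triple_swap] and [is_triple_rot]. *)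
Definition is_triple T p l u v :=
  [/\ l != 0, N p = 1, u \in chords p l /\ v \in chords p l, u != v &
      T = apex_triple p l u v].

Lemma is_triple_swap T p l u v : is_triple T p l u v -> is_triple T p l v u.
Proof.
case=> l0 p1 [cu cv] uv ->; split=> //; first by rewrite eq_sym.
by rewrite /apex_triple setUAC.
Qed.

Lemma is_triple_rot T p l u v :
  is_triple T p l u v -> is_triple T (step p l u) l u (vec u v).
Proof.
case=> l0 p1 [cu cv] uv ->.
have [[ku u0 Nu] [kv v0 Nv]] := (chordsP _ _ _ cu, chordsP _ _ _ cv).
have e1 : step (step p l u) l u = p by apply: pairE; rewrite /step /=; ring2.
have e2 : step (step p l u) l (vec u v) = step p l v.
  by apply: pairE; rewrite /step /=; ring2.
split=> //.
- split; apply/chordsP; rewrite ?e1 ?e2; split=> //; first exact: vec_GFqvec.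
  by rewrite vec_eq0.
- rewrite eq_sym -vec_eq0 vecC /vec /=; apply: contraNneq v0 => -[e3 e4].
  apply/eqP/pairE => /=;
    [apply: (lincomb1 (c := 1) e3) | apply: (lincomb1 (c := 1) e4)]; ring2.
by rewrite /apex_triple e1 e2 (setUC [set p]).
Qed.

Lemma is_triple_card T p l u v : is_triple T p l u v -> #|T| = 3.
Proof.
case=> l0 p1 [cu cv] uv ->; rewrite /apex_triple.
have [[_ u0 _] [_ v0 _]] := (chordsP _ _ _ cu, chordsP _ _ _ cv).
have ne w : w != (0, 0) -> step p l w != p.
  by apply: contra_neq => e; apply: (step_inj (p := p) l0); rewrite step0r.
rewrite setUC cardsU1 cards2 !inE negb_or ne // (eq_sym p) ne //.
by rewrite (inj_eq (step_inj l0)) eq_sym uv.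
Qed.

Lemma baer_triplesP T :
  reflect (exists p l u v, is_triple T p l u v) (T \in baer_triples).
Proof.
rewrite [_ \in _]inE; apply: (iffP idP).
  case/and3P=> sT /eqP/cards3P[x [y [z [xy xz yz eT]]]].
  case/existsP=> w /existsP[l /andP[l0 sl]].
  have inS r : r \in T -> r \in baer_line w l :&: unit_conic.
    by move=> rT; rewrite inE (subsetP sl) ?(subsetP sT).
  have [xS yS zS] : [/\ x \in baer_line w l :&: unit_conic,
                       y \in baer_line w l :&: unit_conic
                       & z \in baer_line w l :&: unit_conic].
    by split; apply: inS; rewrite eT !inE eqxx ?orbT.
  have [|u cu ey] := baer_line_chord l0 xS yS; first by rewrite eq_sym.
  have [|v cv ez] := baer_line_chord l0 xS zS; first by rewrite eq_sym.
  exists x, l, u, v; split=> //.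
  - by case/setIP: xS => _; rewrite inE => /eqP.
  - by apply: contra_neq yz => uv; rewrite ey ez uv.
  - by rewrite eT ey ez.
case=> p [l [u [v tr]]]; rewrite (is_triple_card tr) /=.
case: tr => l0 p1 [cu cv] uv ->.
have [[ku u0 Nu] [kv v0 Nv]] := (chordsP _ _ _ cu, chordsP _ _ _ cv).
apply/andP; split.
  apply/subsetP => r; rewrite !inE -orbA.
  by case/or3P => /eqP->; rewrite ?p1 ?Nu ?Nv.
apply/existsP; exists p; apply/existsP; exists l; rewrite l0.
apply/subsetP => r; rewrite !inE -orbA => /or3P[]/eqP->; apply/imsetP.
- by exists (0, 0); rewrite ?step0r // in_setX GFq0.
- by exists u.
- by exists v.
Qed.

Definition dirset (T : {set F * F}) : {set F * F} :=
  [set norm (vec x.1 x.2) | x in [set x in setX T T | x.1 != x.2]].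

Lemma dirset_triple T p l u v : is_triple T p l u v ->
  dirset T = [set norm u; norm v; norm (vec u v)].
Proof.
case=> l0 p1 [cu cv] uv ->.
have [[ku u0 Nu] [kv v0 Nv]] := (chordsP _ _ _ cu, chordsP _ _ _ cv).
have ne w : w != (0, 0) -> step p l w != p.
  by apply: contra_neq => e; apply: (step_inj (p := p) l0); rewrite step0r.
apply/setP => d; apply/imsetP/idP.
  case=> -[x y]; rewrite inE => /andP[/setXP[xT yT] xy] -> {d}.
  move: xT yT xy; rewrite !inE -!orbA.
  case/or3P => /eqP-> /or3P[] /eqP-> /=; rewrite ?eqxx // => _;
  by rewrite ?(vecC (step _ _ _) p) ?vec_step ?vec_step2 norm_scale //
     ?(vecC v u) eqxx ?orbT.
rewrite !inE -orbA => /or3P[] /eqP->.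
- exists (p, step p l u); rewrite ?vec_step ?norm_scale // !inE !eqxx ?orbT /=.
  by rewrite eq_sym ne.
- exists (p, step p l v); rewrite ?vec_step ?norm_scale // !inE !eqxx ?orbT /=.
  by rewrite eq_sym ne.
- exists (step p l u, step p l v); rewrite ?vec_step2 ?norm_scale //.
  rewrite !inE !eqxx !orbT /=.
  by rewrite (inj_eq (step_inj l0)).
Qed.

Lemma triple_norm_neq T p l u v : is_triple T p l u v -> norm u != norm v.
Proof.
case=> l0 p1 [cu cv] uv _.
have [[_ u0 _] [_ v0 _]] := (chordsP _ _ _ cu, chordsP _ _ _ cv).
have := chords_det l0 p1 cu cv uv; apply: contra_neq; exact: norm_det.
Qed.

(** Two of the three directions single out the vertex where the corresponding
    sides meet. *)
Lemma dirset_rep T d1 d2 : T \in baer_triples -> d1 \in dirset T -> d2 \in dirset T ->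
  d1 != d2 -> exists p l u v, [/\ is_triple T p l u v, norm u = d1 & norm v = d2].
Proof.
case/baer_triplesP => p [l [u [v tr]]]; rewrite (dirset_triple tr) !inE -!orbA.
have tr2 := is_triple_rot tr.
have tr3 := is_triple_swap tr; have tr4 := is_triple_rot tr3.
have tr5 := is_triple_swap tr2; have tr6 := is_triple_swap tr4.
rewrite vecC in tr4 tr6.
case/or3P => /eqP-> /or3P[] /eqP->; rewrite ?eqxx // => _.
- by exists p, l, u, v.
- by exists (step p l u), l, u, (vec u v).
- by exists p, l, v, u.
- by exists (step p l v), l, v, (vec u v).
- by exists (step p l u), l, (vec u v), u.
- by exists (step p l v), l, (vec u v), v.
Qed.

Lemma dirset_good T : T \in baer_triples ->
  dirset T \subset free_dirs /\ #|dirset T| = 3.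
Proof.
case/baer_triplesP => p [l [u [v tr]]]; have tr2 := is_triple_rot tr.
have tr3 := is_triple_rot (is_triple_swap tr).
have n1 := triple_norm_neq tr; have n2 := triple_norm_neq tr2.
have := triple_norm_neq tr3; rewrite vecC => n3.
rewrite (dirset_triple tr); split; last first.
  rewrite setUC cardsU1 cards2 !inE negb_or (eq_sym _ (norm u)) n1 n2.
  by rewrite (eq_sym _ (norm v)) n3.
have [l0 p1 [cu cv] uv _] := tr.
have [[ku u0 _] [kv v0 _]] := (chordsP _ _ _ cu, chordsP _ _ _ cv).
have [Nu Nv] := chords_scale l0 p1 cu cv uv; rewrite step1_vec => Nuv.
have uv0 : vec u v != (0, 0) by rewrite vec_eq0.
apply/subsetP => d dS; rewrite !inE -orbA in dS.
case/or3P: dS => /eqP->; rewrite [_ \in free_dirs]inE;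
  by rewrite N_norm_neq0 // norm_dirs ?vec_GFqvec.
Qed.

(** Choose vertices where the same two directions meet.  Equality of the third
    directions makes the second triple's chords proportional to the first's with
    one factor s; [triple_scale] then fixes the scale and [triple_apex] the
    vertex. *)
Lemma dirset_inj : {in baer_triples &, injective dirset}.
Proof.
move=> T T' /baer_triplesP[p [l [u [v tr]]]] T'P eD.
have tr2 := is_triple_rot tr; have tr3 := is_triple_rot (is_triple_swap tr).
have n1 := triple_norm_neq tr; have n2 := triple_norm_neq tr2.
have := triple_norm_neq tr3; rewrite vecC => n3.
have eS := dirset_triple tr; rewrite eD in eS.
have [||p' [l' [u' [v' [tr' eu ev]]]]] :=
  dirset_rep (d1 := norm u) (d2 := norm v) T'P _ _ n1.
- by rewrite eS !inE eqxx.
- by rewrite eS !inE eqxx orbT.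
have := dirset_triple tr'; rewrite eu ev => eS'.
have {eS eS'} euv : norm (vec u v) = norm (vec u' v').
  by apply: (third_of_three eS eS'); rewrite eq_sym.
have [l0 p1 [cu cv] uv ->] := tr; have [l0' p1' [cu' cv'] uv' ->] := tr'.
have [[ku u0 _] [kv v0 _]] := (chordsP _ _ _ cu, chordsP _ _ _ cv).
have [[_ u0' _] [_ v0' _]] := (chordsP _ _ _ cu', chordsP _ _ _ cv').
have [s es] := det0P u0 (norm_det u0 u0' (esym eu)).
have [t et] := det0P v0 (norm_det v0 v0' (esym ev)).
have s0 : s != 0.
  by apply: contra_neq u0' => s0; rewrite es s0 /step !mul0r !addr0.
have d0 := chords_det l0 p1 cu cv uv.
have est : t = s.
  have : det (vec u v) (vec u' v') = 0 by apply: norm_det; rewrite ?vec_eq0.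
  rewrite es et => e; apply/eqP; rewrite -addr_eq02; apply/eqP; apply: (mulfI d0).
  by rewrite mulr0 -[RHS]e /det /vec /step /=; ring2.
rewrite {}est in et.
have chN w : step (0, 0) s w \in chords p' l' -> l' * s * N w = b * det p' w.
  move/(chords_N l0' p1'); rewrite N_step0 => e; apply: (mulfI s0).
  transitivity (l' * (s ^+ 2 * N w)); first by move: (N w) => A; ring2.
  by rewrite e /det /step /=; ring2.
have e1 : l' * s * N u = b * det p' u by apply: chN; rewrite -es.
have e2 : l' * s * N v = b * det p' v by apply: chN; rewrite -et.
have f1 := chords_N l0 p1 cu; have f2 := chords_N l0 p1 cv.
have els : l' * s = l.
  have [Nu Nv Nuv] := chords_scale l0 p1 cu cv uv.
  have X0 : N u * N v * N (step u 1 v) != 0 by rewrite !mulf_neq0.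
  have /(mulIf X0) e := etrans (triple_scale p1' e1 e2) (esym (triple_scale p1 f1 f2)).
  apply/eqP; rewrite -addr_eq02 -sqrf_eq0; apply/eqP.
  by apply: (lincomb1 (c := 1) e); ring2.
have ep : p = p'.
  rewrite els in e1 e2.
  have e := etrans (triple_apex f1 f2) (esym (triple_apex e1 e2)).
  have bD : b * det u v != 0 by rewrite mulf_neq0.
  by apply: (step_inj bD) e.
have scale w : step p l w = step p' l' (step (0, 0) s w).
  by rewrite -ep -els; apply: pairE; rewrite /step /=; ring2.
by rewrite /apex_triple es et -!scale -ep.
Qed.

(** Three directions satisfy the linear relation
    det(d2,d3) d1 + det(d1,d3) d2 = det(d1,d2) d3.  Taking its terms for u, v
    and u + v, the formulas of [triple_scale] and [triple_apex] are solved for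
    l and p. *)
Lemma dirset_surj (S : {set F * F}) : S \subset free_dirs -> #|S| = 3 ->
  exists2 T, T \in baer_triples & dirset T = S.
Proof.
move=> sS /cards3P[d1 [d2 [d3 [d12 d13 d23 eS]]]].
have [g1 g2 g3] : [/\ d1 \in free_dirs, d2 \in free_dirs & d3 \in free_dirs].
  by split; apply: (subsetP sS); rewrite eS !inE eqxx ?orbT.
move: g1 g2 g3; rewrite [d1 \in _]inE [d2 \in _]inE [d3 \in _]inE.
move=> /andP[i1 N1] /andP[i2 N2] /andP[i3 N3].
have dn x y : x \in dirs -> y \in dirs -> x != y -> det x y != 0.
  move=> ix iy; apply: contra_neq => e; rewrite -(norm_id ix) -(norm_id iy).
  have [t et] := det0P (dirs_neq0 ix) e; rewrite et norm_scale //.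
  by apply: contraNneq (dirs_neq0 iy) => t0; rewrite et t0 /step !mul0r !addr0.
have n12 := dn _ _ i1 i2 d12; have n13 := dn _ _ i1 i3 d13.
have n23 := dn _ _ i2 i3 d23.
pose u := step (0, 0) (det d2 d3) d1; pose v := step (0, 0) (det d1 d3) d2.
have euv : vec u v = step (0, 0) (det d1 d2) d3.
  by apply: pairE; rewrite /vec /u /v /step /det /=; ring2.
have Nu : N u != 0 by rewrite N_step0 mulf_neq0 ?expf_neq0.
have Nv : N v != 0 by rewrite N_step0 mulf_neq0 ?expf_neq0.
have Nuv : N (vec u v) != 0 by rewrite euv N_step0 mulf_neq0 ?expf_neq0.
have D0 : det u v != 0.
  rewrite (_ : det u v = det d2 d3 * det d1 d3 * det d1 d2) ?mulf_neq0 //.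
  by rewrite /u /v /step /det /=; ring2.
have kd x y : x \in dirs -> y \in dirs -> det x y \in k.
  by move=> ix iy; rewrite det_GFqvec ?dirs_GFqvec.
have ksc x t : x \in dirs -> t \in k -> step (0, 0) t x \in GFqvec.
  move=> /dirs_GFqvec; case: x => x1 x2 /setXP[? ?] kt.
  by rewrite in_setX /step /= !add0r !GFqM.
have ku : u \in GFqvec by rewrite ksc ?kd.
have kv : v \in GFqvec by rewrite ksc ?kd.
have nz x t : t != 0 -> x \in dirs -> step (0, 0) t x != (0, 0).
  move=> t0 /dirs_neq0; apply: contra_neq => e; apply: (step_inj (p := (0, 0)) t0).
  by rewrite e step0r.
(* The scale: s is l / (b det u v), by the relation [triple_scale]. *)
have [s es] := sqrt_exists (N u * N v * N (vec u v))^-1.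
pose X := N u * N v * N (vec u v).
have X0 : X != 0 by rewrite !mulf_neq0.
have sX : s ^+ 2 * X = 1 by rewrite es mulVf.
have s0 : s != 0.
  apply: contra_eq_neq sX => ->; rewrite expr0n mul0r; by rewrite eq_sym oner_eq0.
pose l := s * (b * det u v).
have l0 : l != 0 by rewrite !mulf_neq0.
pose p := step (0, 0) s (step (step (0, 0) (N v) u) (N u) v).
have p1 : N p = 1.
  rewrite -[RHS]sX /X -step1_vec N_step /p N_step0 N_comb.
  by move: (N u) (N v) (det u v) => A B D; ring2.
have eu : l * N u = b * det p u.
  rewrite /l /p; move: (N u) (N v) => A B; rewrite /det /step /=; ring2.
have ev : l * N v = b * det p v.
  rewrite /l /p; move: (N u) (N v) => A B; rewrite /det /step /=; ring2.
have tr : is_triple (apex_triple p l u v) p l u v.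
  split=> //.
    split; apply/chordsP; split=> //; rewrite ?nz // N_step p1.
      by rewrite eu addrr2 mulr0 addr0.
    by rewrite ev addrr2 mulr0 addr0.
  by apply: contra_neq D0 => ->; rewrite detuu.
exists (apex_triple p l u v); first by apply/baer_triplesP; exists p, l, u, v.
by rewrite (dirset_triple tr) euv /u /v !norm_scale // !norm_id.
Qed.

Lemma card_baer_triples : #|baer_triples| = 'C(#|free_dirs|, 3).
Proof.
rewrite -cards_draws -(card_in_imset dirset_inj); apply: eq_card => S.
apply/imsetP/idP => [[T TP ->]|].
  by rewrite inE; case: (dirset_good TP) => -> ->.
by rewrite inE => /andP[sS /eqP cS]; case: (dirset_surj sS cS) => T TP <-; exists T.
Qed.

(** * Lines meeting the conic *)

Lemma line_conic_le2 (c0 c1 c2 : F) : (c0 != 0) || (c1 != 0) ->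
  (#|[set p in unit_conic | (c0 * p.1 + c1 * p.2 + c2 == 0)%R]| <= 2)%N.
Proof.
move=> nz; rewrite leqNgt; apply/negP => /card_geqP[s [us ss sS]].
case: s ss us sS => [|x [|y [|z [|]]]] //= _.
rewrite !inE !negb_or !andbT -!andbA => /and3P[xy xz yz] sS.
have inS r : r \in [:: x; y; z] -> N r = 1 /\ c0 * r.1 + c1 * r.2 + c2 = 0.
  by move=> /sS; rewrite !inE => /andP[/eqP ? /eqP ?].
have [[Nx ex] [Ny ey] [Nz ez]] : [/\ N x = 1 /\ c0 * x.1 + c1 * x.2 + c2 = 0,
   N y = 1 /\ c0 * y.1 + c1 * y.2 + c2 = 0 & N z = 1 /\ c0 * z.1 + c1 * z.2 + c2 = 0].
  by split; apply: inS; rewrite !inE eqxx ?orbT.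
have st r : step x 1 (vec x r) = r by apply: pairE; rewrite /step /vec /=; ring2.
have d0 : det (vec x y) (vec x z) = 0.
  have eX : c0 * (vec x y).1 + c1 * (vec x y).2 = 0.
    by apply: (lincomb2 (c := 1) (c' := 1) ex ey); rewrite /vec /=; ring2.
  have eY : c0 * (vec x z).1 + c1 * (vec x z).2 = 0.
    by apply: (lincomb2 (c := 1) (c' := 1) ex ez); rewrite /vec /=; ring2.
  move: eX eY; move: (vec x y) (vec x z) => X Y eX eY.
  case/orP: nz => nz; apply: (mulfI nz); rewrite mulr0.
    by apply: (lincomb2 (c := Y.2) (c' := X.2) eX eY); rewrite /det; ring2.
  by apply: (lincomb2 (c := Y.1) (c' := X.1) eX eY); rewrite /det; ring2.
have := @no_three x (vec x y) (vec x z) Nx; rewrite !st !vec_eq0.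
move=> /(_ Ny Nz xy xz d0)[] /addrI e1 /addrI e2.
by case/eqP: yz; exact: pairE.
Qed.

End Form.

(** * Homogeneous coordinates *)

Definition rv (x y z : F) : 'rV[F]_3 := \row_(i < 3) nth 0 [:: x; y; z] i.
Definition cv (x y z : F) : 'cV[F]_3 := \col_(i < 3) nth 0 [:: x; y; z] i.

Lemma rvP (v : 'rV[F]_3) : v = rv (v 0 0) (v 0 1) (v 0 2%:R).
Proof. by apply/rowP => i; rewrite mxE; case: (ord3 i) => ->. Qed.

Lemma cvP (v : 'cV[F]_3) : v = cv (v 0 0) (v 1 0) (v 2%:R 0).
Proof. by apply/colP => i; rewrite mxE; case: (ord3 i) => ->. Qed.

Lemma rv_eq0 x y z : (rv x y z == 0) = [&& x == 0, y == 0 & z == 0].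
Proof.
apply/eqP/and3P => [/rowP e|[/eqP-> /eqP-> /eqP->]].
  by split; apply/eqP; [have := e 0 | have := e 1 | have := e 2%:R]; rewrite !mxE.
by apply/rowP => i; rewrite !mxE; case: (ord3 i) => ->.
Qed.

Lemma cv_eq0 x y z : (cv x y z == 0) = [&& x == 0, y == 0 & z == 0].
Proof.
apply/eqP/and3P => [/colP e|[/eqP-> /eqP-> /eqP->]].
  by split; apply/eqP; [have := e 0 | have := e 1 | have := e 2%:R]; rewrite !mxE.
by apply/colP => i; rewrite !mxE; case: (ord3 i) => ->.
Qed.

Lemma rv_cv x y z x' y' z' :
  (rv x y z *m cv x' y' z') 0 0 = x * x' + y * y' + z * z'.
Proof. by rewrite mxE !big_ord_recl big_ord0 !mxE /= addr0 addrA. Qed.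

Lemma scale_rv t x y z : t *: rv x y z = rv (t * x) (t * y) (t * z).
Proof. by apply/rowP => i; rewrite !mxE; case: (ord3 i) => ->. Qed.

Lemma hpointE (x y z : F) : hpoint x y z = <<rv x y z>>%MS. Proof. by []. Qed.

Lemma pg_pointP (v : 'rV[F]_3) : (<<v>>%MS \in pg_points F) = (v != 0).
Proof.
rewrite inE; apply/existsP/idP => [[w /andP[w0 /eqP/genmxP e]]|v0]; last first.
  by exists v; rewrite v0 eqxx.
apply: contraNneq w0 => v0; move/andP: e => [_].
by rewrite v0 => /sub_rVP[t ->]; rewrite scaler0.
Qed.

Lemma hpoint_pg (x y z : F) :
  (hpoint x y z \in pg_points F) = ~~ [&& x == 0, y == 0 & z == 0].
Proof. by rewrite hpointE pg_pointP rv_eq0. Qed.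

Lemma hpoint_scale (t x y z : F) : t != 0 ->
  hpoint (t * x) (t * y) (t * z) = hpoint x y z.
Proof.
by move=> t0; rewrite !hpointE -scale_rv; apply/eq_genmx; exact: eqmx_scale.
Qed.

Lemma hpoint_inj (x y z x' y' z' : F) : hpoint x y z = hpoint x' y' z' ->
  exists t, [/\ x = t * x', y = t * y' & z = t * z'].
Proof.
move/genmxP/andP => [/sub_rVP[t]]; rewrite scale_rv => /rowP e _; exists t.
by split; [have := e 0 | have := e 1 | have := e 2%:R]; rewrite !mxE.
Qed.

Lemma hpoint_line (x y z l0 l1 l2 : F) : (hpoint x y z \in line_of (cv l0 l1 l2)) =
  ~~ [&& x == 0, y == 0 & z == 0] && (x * l0 + y * l1 + z * l2 == 0).
Proof.
rewrite inE hpoint_pg; congr andb.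
have -> : (hpoint x y z *m cv l0 l1 l2 == 0) = (rv x y z *m cv l0 l1 l2 == 0).
  by rewrite -!submx0 (eqmxMr _ (genmxE _)) .
rewrite -rv_cv; apply/eqP/eqP => [->|e]; first by rewrite mxE.
by apply/matrixP => i j; rewrite !ord1 e mxE.
Qed.

Definition aff (p : F * F) := hpoint p.1 p.2 1.
Definition inf (u : F * F) := hpoint u.1 u.2 0.

Lemma aff_inj : injective aff.
Proof.
move=> p r /hpoint_inj[t [e1 e2]]; rewrite mulr1 => e3.
by apply: pairE; rewrite ?e1 ?e2 -e3 mul1r.
Qed.

Lemma aff_neq_inf p u : aff p != inf u.
Proof.
by apply/eqP => /hpoint_inj[t [_ _ /eqP]]; rewrite mulr0 oner_eq0.
Qed.

Lemma inf_det u v : inf u = inf v -> det u v = 0.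
Proof. by case/hpoint_inj => t [e1 e2 _]; rewrite /det e1 e2; ring2. Qed.

Lemma inf_scale t u : t != 0 -> inf (step (0, 0) t u) = inf u.
Proof.
by move=> t0; rewrite -[RHS](hpoint_scale _ _ _ t0) /inf /step /= !add0r mulr0.
Qed.

Lemma inf_norm u : u != (0, 0) -> inf (norm u) = inf u.
Proof. by case/normE => t t0 ->; rewrite inf_scale. Qed.

Lemma det_inf u v : u != (0, 0) -> v != (0, 0) -> det u v = 0 -> inf u = inf v.
Proof.
move=> u0 v0 /(det0P u0)[t et]; rewrite et inf_scale //.
by apply: contraNneq v0 => t0; rewrite et t0 /step !mul0r !addr0.
Qed.

Lemma aff_pg p : aff p \in pg_points F.
Proof. by rewrite hpoint_pg oner_eq0 !andbF. Qed.

Lemma inf_pg u : (inf u \in pg_points F) = (u != (0, 0)).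
Proof. by rewrite hpoint_pg eqxx andbT; case: u. Qed.

(** Points at infinity are kept as directions, the others as affine points. *)
Lemma pg_cases P : P \in pg_points F ->
  (exists p, P = aff p) \/ (exists2 u, u != (0, 0) & P = inf u).
Proof.
rewrite inE => /existsP[v /andP[]]; rewrite (rvP v).
move: (v 0 0) (v 0 1) (v 0 2%:R) => x y z; rewrite -hpointE rv_eq0 => nz /eqP->.
case: (eqVneq z 0) => z0.
  by right; exists (x, y); rewrite /inf ?z0 //; move: nz; rewrite z0 eqxx andbT.
left; exists (x / z, y / z); rewrite /aff -[RHS](hpoint_scale _ _ _ z0) /= mulr1.
by rewrite ![z * _]mulrC !divfK.
Qed.

Lemma aff_line p c0 c1 c2 :
  (aff p \in line_of (cv c0 c1 c2)) = (c0 * p.1 + c1 * p.2 + c2 == 0).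
Proof.
by rewrite hpoint_line oner_eq0 !andbF /= mul1r ![_ * c0]mulrC ![_ * c1]mulrC.
Qed.

Lemma inf_line u c0 c1 c2 : u != (0, 0) ->
  (inf u \in line_of (cv c0 c1 c2)) = (c0 * u.1 + c1 * u.2 == 0).
Proof.
move=> u0; rewrite hpoint_line eqxx andbT mul0r addr0 ![_ * c0]mulrC ![_ * c1]mulrC.
by move: u0; case: u => x y; rewrite xpair_eqE => ->.
Qed.

Lemma line_infE : line_inf F = line_of (cv 0 0 1). Proof. by []. Qed.

Lemma line_inf_scaled c2 : c2 != 0 -> line_of (cv 0 0 c2) = line_inf F.
Proof.
move=> c20; apply/setP => Q; rewrite !inE; congr andb.
have -> : cv 0 0 c2 = c2 *: cv 0 0 1.
  by apply/colP => i; rewrite !mxE; case: (ord3 i) => -> /=; rewrite ?mulr0 ?mulr1.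
by rewrite -scalemxAr scaler_eq0 (negPf c20).
Qed.

Lemma aff_line_inf p : aff p \notin line_inf F.
Proof. by rewrite line_infE aff_line !mul0r !add0r oner_eq0. Qed.

Lemma inf_line_inf u : (inf u \in line_inf F) = (u != (0, 0)).
Proof.
apply/idP/idP; last by move=> u0; rewrite line_infE inf_line // !mul0r addr0.
by rewrite inE inf_pg => /andP[].
Qed.

Lemma pg_linesP m : m \in pg_lines F ->
  exists c0 c1 c2, m = line_of (cv c0 c1 c2) /\ ~~ [&& c0 == 0, c1 == 0 & c2 == 0].
Proof.
case/imsetP => l; rewrite inE => l0 ->; exists (l 0 0), (l 1 0), (l 2%:R 0).
by rewrite -cvP -cv_eq0 -cvP.
Qed.

Lemma pg_lines_cv c0 c1 c2 : ~~ [&& c0 == 0, c1 == 0 & c2 == 0] ->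
  line_of (cv c0 c1 c2) \in pg_lines F.
Proof. by move=> nz; apply/imsetP; exists (cv c0 c1 c2); rewrite // inE cv_eq0. Qed.

Lemma line_inf_pg : line_inf F \in pg_lines F.
Proof. by apply: pg_lines_cv; rewrite oner_eq0 !andbF. Qed.

(** The line through the affine point p in direction u. *)
Definition aline (p u : F * F) := line_of (cv u.2 u.1 (det p u)).

Lemma aline_line p u : u != (0, 0) -> aline p u \in pg_lines F.
Proof.
case: u => x y u0; apply: pg_lines_cv => /=; apply: contra u0.
by case/and3P=> /eqP-> /eqP-> _.
Qed.

Lemma aff_aline r p u : (aff r \in aline p u) = (det (vec p r) u == 0).
Proof.
rewrite aff_line; congr (_ == _); rewrite /det /vec /=; ring2.
Qed.

Lemma inf_aline v p u : v != (0, 0) -> (inf v \in aline p u) = (det u v == 0).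
Proof.
by move=> v0; rewrite inf_line // mulrC [u.1 * _]mulrC /det addrC mulrC [u.2 * _]mulrC.
Qed.

Lemma derivationE : derivation_set F q = inf @: dirs.
Proof.
apply/setP => P; apply/imsetP/imsetP => -[u].
  rewrite inE andbA => /andP[ku u0] ->; exists (norm u); last by rewrite inf_norm.
  by apply: norm_dirs => //; case: u ku {u0} => x y; rewrite in_setX.
move=> ud ->; exists u => //; rewrite inE andbA dirs_neq0 // andbT.
by have := dirs_GFqvec ud; case: (u) => x y; rewrite in_setX.
Qed.

Lemma inf_dirs_inj : {in dirs &, injective inf}.
Proof.
move=> u v iu iv /inf_det/(det0P (dirs_neq0 iu))[t et].
rewrite -(norm_id iu) -(norm_id iv) et norm_scale //.
by apply: contraNneq (dirs_neq0 iv) => t0; rewrite et t0 /step !mul0r !addr0.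
Qed.

Lemma derivation_line_inf : derivation_set F q \subset line_inf F.
Proof.
apply/subsetP => P; rewrite derivationE => /imsetP[d dd ->].
by rewrite inf_line_inf dirs_neq0.
Qed.

Lemma card_derivation : #|derivation_set F q| = q.+1.
Proof. by rewrite derivationE card_in_imset ?card_dirs //; exact: inf_dirs_inj. Qed.

(** * Baer subplanes through the derivation set *)

Section Subplane.
Variable B : {set 'M[F]_3}.
Hypotheses (subB : subplane_of_order q B) (DB : derivation_set F q \subset B).

Let A := [set p | aff p \in B].

Lemma subB_line m : m \in sublines B -> #|m| = q.+1.
Proof. by case/and4P: subB => _ _ _ /forall_inP H /H/eqP. Qed.

Lemma sublineI l P R : l \in pg_lines F -> P != R -> P \in l :&: B -> R \in l :&: B ->
  l :&: B \in sublines B.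
Proof.
move=> pl PR Pl Rl; apply/imsetP; exists l => //; rewrite inE pl /=.
apply: leq_trans (_ : #|[set P; R]| <= _)%N; first by rewrite cards2 PR.
by apply/subset_leq_card/subsetP => x; rewrite !inE => /orP[]/eqP->; rewrite -in_setI.
Qed.

Lemma dirs_B d : d \in dirs -> inf d \in B.
Proof. by move=> dd; apply: (subsetP DB); rewrite derivationE imset_f. Qed.

Lemma line_inf_subline : line_inf F :&: B \in sublines B.
Proof.
apply: (@sublineI _ (inf (1, 0)) (inf (0, 1))).
- exact: line_inf_pg.
- apply/eqP => /(inf_dirs_inj dirs10 dirs01) [] /eqP; by rewrite oner_eq0.
- by rewrite in_setI inf_line_inf dirs_neq0 ?dirs_B ?dirs10.
- by rewrite in_setI inf_line_inf dirs_neq0 ?dirs_B ?dirs01.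
Qed.

(** The line at infinity is a line of the subplane, so it contributes exactly
    q + 1 points, as many as D has. *)
Lemma inf_B : line_inf F :&: B = derivation_set F q.
Proof.
apply/esym/eqP; rewrite eqEcard card_derivation.
rewrite subB_line ?line_inf_subline // leqnn andbT.
apply/subsetP => P DP; rewrite in_setI (subsetP DB) // andbT.
by move: DP; rewrite derivationE => /imsetP[d dd ->]; rewrite inf_line_inf dirs_neq0.
Qed.

(** The line joining two affine points meets the line at infinity in a point of
    the subplane. *)
Lemma A_dir p r : p \in A -> r \in A -> p != r ->
  exists2 d, d \in dirs & det (vec p r) d = 0.
Proof.
rewrite !inE => pB rB pr; have v0 : vec p r != (0, 0) by rewrite vec_eq0.
have m1 : aline p (vec p r) :&: B \in sublines B.
  apply: (@sublineI _ (aff p) (aff r)); first exact: aline_line.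
  - by apply: contra_neq pr; exact: aff_inj.
  - by rewrite in_setI pB andbT aff_aline /det /vec; apply/eqP; rewrite /=; ring2.
  - by rewrite in_setI rB andbT aff_aline vecC detuu.
case/and4P: subB => _ /forall_inP/(_ _ m1)/forall_inP/(_ _ line_inf_subline).
case/set0Pn=> P; rewrite inf_B derivationE => /setIP[/setIP[Pl _] /imsetP[d dd eP]] _ _.
by exists d => //; move: Pl; rewrite eP inf_aline ?dirs_neq0 // => /eqP.
Qed.

(** The line through p in direction d is a line of the subplane, with q + 1
    points, one of which is at infinity. *)
Lemma A_line p d : p \in A -> d \in dirs ->
  #|[set r in A | det (vec p r) d == 0]| = q.
Proof.
rewrite inE => pB dd; have dn0 := dirs_neq0 dd.
have m1 : aline p d :&: B \in sublines B.
  apply: (@sublineI _ (aff p) (inf d)); first exact: aline_line.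
  - exact: aff_neq_inf.
  - by rewrite in_setI pB andbT aff_aline /det /vec; apply/eqP; rewrite /=; ring2.
  - by rewrite in_setI dirs_B ?andbT // inf_aline // detuu.
have := subB_line m1.
have -> : aline p d :&: B = inf d |: aff @: [set r in A | det (vec p r) d == 0].
  case/and4P: subB => /subsetP Bpg _ _ _.
  apply/setP => P; apply/setIP/setU1P => [[Pl PB]|].
    case: (pg_cases (Bpg _ PB)) => [[r eP]|[u u0 eP]].
      right; rewrite eP; apply: imset_f; rewrite inE -aff_aline -eP Pl inE.
      by rewrite -eP PB.
    left; rewrite eP; apply: det_inf => //.
    by apply/eqP; move: Pl; rewrite eP inf_aline // detC.
  case=> [->|/imsetP[r]]; first by rewrite dirs_B // inf_aline // detuu.
  by rewrite inE => /andP[]; rewrite inE => rB dr ->; rewrite aff_aline dr.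
rewrite cardsU1 card_imset; last exact: aff_inj.
rewrite (_ : inf d \notin _) => [[]//|].
by apply/imsetP => -[r _ /eqP]; rewrite eq_sym (negPf (aff_neq_inf _ _)).
Qed.

Lemma A_nonempty : exists p, p \in A.
Proof.
case/and4P: subB => /subsetP Bpg _ /existsP[Q /andP[QB quadQ]] _.
move: quadQ => /andP[/eqP Q4 /forall_inP QL].
have QI : (#|line_inf F :&: Q| <= 2)%N by apply: QL; exact: line_inf_pg.
have : (0 < #|Q :\: line_inf F|)%N.
  by have := cardsID (line_inf F) Q; rewrite Q4 setIC; move: QI; clear; lia.
case/card_gt0P => P /setDP[PQ PI]; have PB := subsetP QB _ PQ.
case: (pg_cases (Bpg _ PB)) => [[r eP]|[u u0 eP]]; first by exists r; rewrite inE -eP.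
by rewrite eP inf_line_inf u0 in PI.
Qed.

(** The directions of r - p and r - p - l u are both in D; intersecting the two
    lines by Cramer's rule gives coordinates in l GF(q). *)
Lemma A_baer_line p l u r : l != 0 -> u \in GFqvec -> p \in A ->
  step p l u \in A -> r \in A -> det (vec p r) u != 0 -> r \in baer_line p l.
Proof.
move=> l0 ku pA p1A rA nz.
have pr : p != r.
  by rewrite -vec_eq0; apply: contraNneq nz => ->; rewrite /det /= !mul0r addr0.
have p1r : step p l u != r.
  by apply: contraNneq nz => <-; rewrite vec_step /det /step /=; apply/eqP; ring2.
have [d dd ed] := A_dir pA rA pr; have [d' dd' ed'] := A_dir p1A rA p1r.
have [m em] : exists m, vec p r = step (0, 0) m d.
  by apply: det0P; rewrite ?dirs_neq0 // detC.
have er := vec_stepE em.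
have e : m * det d d' = l * det u d'.
  by apply: (lincomb1 (c := 1) ed'); rewrite er /det /vec /step /=; ring2.
have nd : det d d' != 0.
  apply: contraNneq nz => z; move/esym/eqP: e.
  rewrite z mulr0 mulf_eq0 (negPf l0) /= => /eqP e.
  have [t et] := det0P (dirs_neq0 dd') (etrans (detC _ _) z).
  have [s es] := det0P (dirs_neq0 dd') (etrans (detC _ _) e).
  by rewrite em et es /det /step /=; apply/eqP; ring2.
apply/imsetP; exists (step (0, 0) (det u d' / det d d') d).
  apply: GFqvec_step; first exact: dirs_GFqvec.
  by apply: GFqdiv; apply: det_GFqvec => //; exact: dirs_GFqvec.
have em' : m = l * (det u d' / det d d') by rewrite mulrA -e mulfK.
by rewrite er em'; move: (_ / _) => z; apply: pairE; rewrite /step /=; ring2.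
Qed.

(** Two affine points with difference l (1,0) fix p and l.  Points off their line
    are covered by [A_baer_line]; the points on that line are covered by using
    a point r2 off the line in place of the second one.  Counting along each
    direction then gives equality. *)
Lemma subplane_baer_line : exists w l, l != 0 /\ affine_part B = aff @: baer_line w l.
Proof.
have [p pA] := A_nonempty.
have other d : d \in dirs -> exists r, [/\ r \in A, det (vec p r) d = 0 & p != r].
  move=> dd; have := A_line pA dd => cA.
  set S := [set r in A | _] in cA; have : (0 < #|S :\ p|)%N.
    have := cardsD1 p S; rewrite cA.
    by case: (_ \in _); move: hq4; clear; lia.
  case/card_gt0P => r; rewrite !inE => /and3P[rp rA /eqP e]; exists r; split=> //.
    by rewrite inE.
  by rewrite eq_sym.
have [r1 [r1A e1 pr1]] := other _ dirs10.
have [l el] : exists l, vec p r1 = step (0, 0) l (1, 0).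
  by apply: det0P; rewrite ?dirs_neq0 ?dirs10 // detC.
have er1 := vec_stepE el.
have l0 : l != 0.
  by apply: contra_neq pr1 => l0; rewrite er1 l0 /step !mul0r !addr0; case: (p).
exists p, l; split=> //.
have AS : {subset A <= baer_line p l}.
  have [r2 [r2A e2 pr2]] := other _ dirs01.
  have par r : det (vec p r) (0, 1) = 0 -> det (vec p r) (1, 0) = 0 -> p = r.
    rewrite /det /= !mulr1 !mulr0 addr0 add0r => z1 z2.
    by apply/eqP; rewrite -vec_eq0; apply/eqP/pairE.
  have nz2 : det (vec p r2) (1, 0) != 0 by apply: contra_neq pr2; exact: par.
  have r2b : r2 \in baer_line p l.
    by apply: (A_baer_line l0 (dirs_GFqvec dirs10)); rewrite -?er1 ?dirs_neq0 ?dirs10.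
  case/imsetP: r2b => u2 ku2 er2.
  have u20 : u2 != (0, 0) by apply: contra_neq pr2 => z; rewrite er2 z step0r.
  move=> r rA; case: (eqVneq (det (vec p r) (1, 0)) 0) => [z|]; last first.
    move=> nz; apply: (A_baer_line l0 (dirs_GFqvec dirs10)) nz;
      by rewrite -?er1 ?dirs_neq0 ?dirs10.
  case: (eqVneq p r) => [<-|pr].
    by apply/imsetP; exists (0, 0); rewrite ?step0r // in_setX GFq0.
  apply: (A_baer_line l0 ku2); rewrite -?er2 //.
  have [m em] : exists m, vec p r = step (0, 0) m (1, 0).
    by apply: det0P; rewrite ?dirs_neq0 ?dirs10 // detC.
  have m0 : m != 0.
    by apply: contra_neq pr => m0; rewrite (vec_stepE em) m0 /step !mul0r !addr0; case: (p).
  rewrite em; apply: contraNneq nz2 => z2; rewrite er2 vec_step.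
  apply/eqP; apply: (mulfI m0); rewrite mulr0.
  transitivity (l * det (step (0, 0) m (1, 0)) u2); last by rewrite z2 mulr0.
  by rewrite /det /step /=; ring2.
have SA r : r \in baer_line p l -> r \in A.
  case/imsetP=> u ku ->; case: (eqVneq u (0, 0)) => [->|u0]; first by rewrite step0r.
  have dd := norm_dirs ku u0; set d := norm u in dd.
  pose M := [set step p l (step (0, 0) t d) | t in k].
  (* The left-hand side has q elements by [A_line], the right-hand side at most q. *)
  have LM : [set r in A | det (vec p r) d == 0] = M.
    apply/eqP; rewrite eqEcard A_line //.
    rewrite (leq_trans (leq_imset_card _ _)) ?card_GFq // andbT.
    apply/subsetP => s; rewrite inE => /andP[/AS/imsetP[v kv ->]].
    rewrite vec_step => /eqP z.
    have [|t kt ->] := GFqvec_par dd kv; last by apply: imset_f.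
    apply: (mulfI l0); rewrite mulr0 -[RHS]z; rewrite /det /step /=; ring2.
  have : step p l u \in M.
    have [|t kt ->] := GFqvec_par dd ku; last by apply: imset_f.
    by rewrite /d; have [t t0 ->] := normE u0; rewrite /det /step /=; ring2.
  by rewrite -LM inE => /andP[].
case/and4P: subB => /subsetP Bpg _ _ _.
apply/setP => P; apply/setDP/imsetP => [[PB PI]|[r /SA]].
  case: (pg_cases (Bpg _ PB)) => [[r eP]|[u u0 eP]].
    by exists r => //; apply: AS; rewrite inE -eP.
  by rewrite eP inf_line_inf u0 in PI.
by rewrite inE => rB ->; split=> //; exact: aff_line_inf.
Qed.

End Subplane.

Section BaerLineSubplane.
Variables (w : F * F) (l : F).
Hypothesis l0 : l != 0.

Let B := derivation_set F q :|: aff @: baer_line w l.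

Lemma inf_bplane u : u != (0, 0) ->
  (inf u \in B) = (inf u \in derivation_set F q).
Proof.
move=> u0; rewrite in_setU; case: (inf u \in _) => //=.
by apply/imsetP => -[p _ /eqP]; rewrite eq_sym (negPf (aff_neq_inf _ _)).
Qed.

Lemma aff_bplane p : (aff p \in B) = (p \in baer_line w l).
Proof.
rewrite in_setU (mem_imset _ _ aff_inj) derivationE; case: imsetP => //=.
by case=> d _ /eqP; rewrite (negPf (aff_neq_inf _ _)).
Qed.

Lemma bplane_pg : B \subset pg_points F.
Proof.
apply/subsetP => P /setUP[|/imsetP[p _ ->]]; last exact: aff_pg.
by rewrite derivationE => /imsetP[d dd ->]; rewrite inf_pg dirs_neq0.
Qed.

Lemma inf_bplane_dirs d : d \in dirs -> inf d \in B.
Proof. by move=> dd; rewrite inf_bplane ?dirs_neq0 // derivationE imset_f. Qed.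

Lemma line_inf_bplane : line_inf F :&: B = derivation_set F q.
Proof.
apply/setP => P; rewrite in_setI; apply/andP/idP => [[PI PB]|PD].
  case: (pg_cases (subsetP bplane_pg _ PB)) => [[p eP]|[u u0 eP]].
    by rewrite eP (negPf (aff_line_inf _)) in PI.
  by rewrite eP inf_bplane // -eP in PB.
rewrite /B in_setU PD; split=> //.
by move: PD; rewrite derivationE => /imsetP[d dd ->]; rewrite inf_line_inf dirs_neq0.
Qed.

Lemma baer_line_shift p r : p \in baer_line w l -> r \in baer_line w l ->
  exists2 u, u \in GFqvec & r = step p l u.
Proof.
case/imsetP=> u ku -> /imsetP[v kv ->]; exists (vec u v); first exact: vec_GFqvec.
by apply: pairE; rewrite /step /vec /=; ring2.
Qed.

Lemma baer_line_step p u : p \in baer_line w l -> u \in GFqvec ->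
  step p l u \in baer_line w l.
Proof.
case/imsetP=> v kv -> ku; apply/imsetP; exists (vec v u); first exact: vec_GFqvec.
by apply: pairE; rewrite /step /vec /=; ring2.
Qed.

(** The sublines other than D, with one point at infinity and q affine points. *)
Definition dline p d : {set 'M[F]_3} :=
  inf d |: [set aff (step p l (step (0, 0) t d)) | t in k].

Lemma card_dline p d : d \in dirs -> #|dline p d| = q.+1.
Proof.
move=> dd; rewrite cardsU1 card_imset ?card_GFq.
  rewrite (_ : _ \notin _) //; apply/imsetP => -[t _ /eqP].
  by rewrite eq_sym (negPf (aff_neq_inf _ _)).
move=> s t /aff_inj/(step_inj l0); case; rewrite !add0r.
move: (dirs_neq0 dd); case: d {dd} => x y; rewrite xpair_eqE negb_and /=.
by case/orP=> nz e1 e2; [exact: (mulIf nz) e1 | exact: (mulIf nz) e2].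
Qed.

Lemma line_dline m p d : m \in pg_lines F -> p \in baer_line w l -> d \in dirs ->
  aff p \in m -> inf d \in m -> m :&: B = dline p d.
Proof.
move=> /pg_linesP[c0 [c1 [c2 [-> nz]]]] pb dd; rewrite aff_line inf_line ?dirs_neq0 //.
move=> /eqP pm /eqP dm.
have c0' : (c0 != 0) || (c1 != 0).
  rewrite -negb_and; apply: contra nz => /andP[/eqP z0 /eqP z1].
  by rewrite z0 z1 !eqxx /= -pm z0 z1 !mul0r !add0r.
have key v : (c0 * v.1 + c1 * v.2 == 0) = (det v d == 0).
  apply/eqP/eqP => e.
    case/orP: c0' => nz0; apply: (mulfI nz0); rewrite mulr0.
      by apply: (lincomb2 (c := d.2) (c' := v.2) e dm); rewrite /det; ring2.
    by apply: (lincomb2 (c := d.1) (c' := v.1) e dm); rewrite /det; ring2.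
  have [t ->] := det0P (dirs_neq0 dd) (etrans (detC _ _) e).
  by apply: (lincomb1 (c := t) dm); rewrite /step /=; ring2.
apply/setP => P; rewrite in_setI; apply/andP/idP => [[Pm PB]|].
  case: (pg_cases (subsetP bplane_pg _ PB)) => [[r eP]|[u u0 eP]].
    rewrite eP aff_bplane in PB; have [u ku er] := baer_line_shift pb PB.
    rewrite eP er aff_line in Pm.
    have : c0 * u.1 + c1 * u.2 == 0.
      apply/eqP; apply: (mulfI l0); rewrite mulr0.
      by apply: (lincomb2 (c := 1) (c' := 1) pm (eqP Pm)); rewrite /step /=; ring2.
    rewrite key => /eqP/(GFqvec_par dd ku)[t kt eu].
    by apply/setU1P; right; apply/imsetP; exists t; rewrite // eP er eu.
  rewrite eP inf_line // key in Pm; apply/setU1P; left; rewrite eP.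
  exact: det_inf u0 (dirs_neq0 dd) (eqP Pm).
case/setU1P => [->|/imsetP[t kt ->]].
  by rewrite inf_bplane_dirs // inf_line ?dirs_neq0 // dm.
rewrite aff_bplane baer_line_step ?GFqvec_step ?dirs_GFqvec // aff_line; split=> //.
by apply/eqP; apply: (lincomb2 (c := 1) (c' := l * t) pm dm); rewrite /step /=; ring2.
Qed.

Lemma sublines_bplane m : m \in sublines B -> m = derivation_set F q \/
  exists p d, [/\ p \in baer_line w l, d \in dirs & m = dline p d].
Proof.
case/imsetP => L; rewrite inE => /andP[pL cL] ->.
have [P [R [/setIP[PL PB] /setIP[RL RB] PR]]] := card_gt1P cL.
have affinf p d : p \in baer_line w l -> d \in dirs -> aff p \in L -> inf d \in L ->
    L :&: B = derivation_set F q \/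
    exists p d, [/\ p \in baer_line w l, d \in dirs & L :&: B = dline p d].
  by move=> pb dd pL' dL; right; exists p, d; split=> //; exact: line_dline.
have infB u : u != (0, 0) -> inf u \in B -> exists2 d, d \in dirs & inf u = inf d.
  by move=> u0; rewrite inf_bplane // derivationE => /imsetP[d dd ->]; exists d.
case: (pg_cases (subsetP bplane_pg _ PB)) => [[p eP]|[u u0 eP]];
case: (pg_cases (subsetP bplane_pg _ RB)) => [[r eR]|[v v0 eR]];
  rewrite ?eP ?eR ?aff_bplane in PL PB RL RB PR.
- have [u ku er] := baer_line_shift PB RB.
  have u0 : u != (0, 0) by apply: contra_neq PR => z; rewrite er z step0r.
  apply: (affinf p (norm u)) => //; first exact: norm_dirs.
  rewrite inf_norm //; move: pL PL RL => /pg_linesP[c0 [c1 [c2 [-> nz]]]].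
  rewrite !aff_line inf_line // er => /eqP e1 /eqP e2.
  apply/eqP; apply: (mulfI l0); rewrite mulr0.
  by apply: (lincomb2 (c := 1) (c' := 1) e1 e2); rewrite /step /=; ring2.
- have [d dd ed] := infB _ v0 RB; rewrite ed in RL; exact: (affinf p d).
- have [d dd ed] := infB _ u0 PB; rewrite ed in PL; exact: (affinf r d).
left; rewrite -line_inf_bplane; congr (_ :&: _).
move: pL PL RL => /pg_linesP[c0 [c1 [c2 [-> nz]]]].
rewrite !inf_line // => /eqP e1 /eqP e2.
have D0 : det u v != 0 by apply: contra_neq PR; exact: det_inf.
have z0 : c0 = 0.
  apply: (mulfI D0); rewrite mulr0.
  by apply: (lincomb2 (c := v.2) (c' := u.2) e1 e2); rewrite /det; ring2.
have z1 : c1 = 0.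
  apply: (mulfI D0); rewrite mulr0.
  by apply: (lincomb2 (c := v.1) (c' := u.1) e1 e2); rewrite /det; ring2.
by rewrite z0 z1 !eqxx /= in nz; rewrite z0 z1 line_inf_scaled.
Qed.

(** The sublines are D and the sets [dline p d].  Two of these with independent
    directions meet in a point with coordinates in GF(q) by Cramer's rule.  The
    quadrangle consists of two points of D, the point w and w + l (1,1). *)
Lemma bplane_order : subplane_of_order q B.
Proof.
apply/and4P; split; first exact: bplane_pg.
- have meet_D p d : d \in dirs -> dline p d :&: derivation_set F q != set0.
    move=> dd; apply/set0Pn; exists (inf d).
    by rewrite in_setI setU11 derivationE imset_f.
  apply/forall_inP => m1 /sublines_bplane[->|[p1 [d1 [p1b dd1 ->]]]];
  apply/forall_inP => m2 /sublines_bplane[->|[p2 [d2 [p2b dd2 ->]]]].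
  + by rewrite setIid -card_gt0 card_derivation.
  + by rewrite setIC meet_D.
  + by rewrite meet_D.
  case: (eqVneq (det d1 d2) 0) => [z|nz].
    apply/set0Pn; exists (inf d1); rewrite in_setI setU11 /=.
    by rewrite (det_inf _ _ z) ?dirs_neq0 // setU11.
  have [u ku e2] := baer_line_shift p1b p2b.
  have ku1 := dirs_GFqvec dd1; have ku2 := dirs_GFqvec dd2.
  have eu := cramer u nz.
  apply/set0Pn; exists (aff (step p1 l (step (0, 0) (det u d2 / det d1 d2) d1))).
  rewrite in_setI; apply/andP; split; apply/setU1P; right; apply/imsetP.
    by exists (det u d2 / det d1 d2); rewrite // GFqdiv ?det_GFqvec.
  exists (det d1 u / det d1 d2); first by rewrite GFqdiv ?det_GFqvec.
  rewrite e2 {2}eu; move: (_ / _) (_ / _) => x y; congr aff.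
  by apply: pairE; rewrite /step /=; ring2.
- apply/existsP; exists ([set inf (1, 0); inf (0, 1)] :|:
                         [set aff w; aff (step w l (1, 1))]).
  have wb : w \in baer_line w l.
    by apply/imsetP; exists (0, 0); rewrite ?step0r // in_setX GFq0.
  have wb' : step w l (1, 1) \in baer_line w l.
    by rewrite baer_line_step // in_setX GFq1.
  have ne1 : inf (1, 0) != inf (0, 1).
    by apply/eqP => /(inf_dirs_inj dirs10 dirs01) [] /eqP; rewrite oner_eq0.
  have ne2 : aff w != aff (step w l (1, 1)).
    rewrite (inj_eq aff_inj); apply/eqP => /(congr1 (fun x => x.1)) /eqP.
    by rewrite /step /= mulr1 -subr_eq0 opprD addrA subrr sub0r oppr_eq0 (negPf l0).
  apply/andP; split.
    apply/subsetP => P; rewrite in_setU !in_set2 -orbA.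
    by case/or4P => /eqP->; rewrite ?aff_bplane // inf_bplane_dirs ?dirs10 ?dirs01.
  apply/andP; split.
    rewrite cardsU !cards2 ne1 ne2 (_ : _ :&: _ = set0) ?cards0 //.
    apply/setP => P; rewrite in_setI !in_set2 in_set0; apply/negP.
    case/andP => /orP[] /eqP->; rewrite ![inf _ == _]eq_sym;
      by rewrite !(negPf (aff_neq_inf _ _)).
  apply/forall_inP => L /pg_linesP[c0 [c1 [c2 [-> nz]]]].
  have [u10 u01] : (1, 0) != (0, 0) :> F * F /\ (0, 1) != (0, 0) :> F * F.
    by rewrite !dirs_neq0 ?dirs10 ?dirs01.
  have cI P : #|line_of (cv c0 c1 c2) :&: [set P]| = (P \in line_of (cv c0 c1 c2)).
    case: (boolP (P \in _)) => PL; last first.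
      by apply/eqP; rewrite cards_eq0 setI_eq0 disjoint_sym disjoints1.
    by apply/eqP/cards1P; exists P; apply/setIidPr; rewrite sub1set.
  rewrite !setIUr.
  apply: leq_trans (leq_card_setU _ _) _.
  apply: leq_trans (leq_add (leq_card_setU _ _) (leq_card_setU _ _)) _.
  rewrite !cI !aff_line !inf_line //= !mulr0 !mulr1 !addr0 !add0r.
  case: (eqVneq c0 0) nz => [->|n0]; case: (eqVneq c1 0) => [->|n1] //= nz.
  + by rewrite !mul0r !add0r (negPf nz).
  + case: eqP => // e1; case: eqP => // e2; exfalso; case/negP: n1; apply/eqP.
    by apply: (mulfI l0); apply: (lincomb2 (c := 1) (c' := 1) e1 e2); ring2.
  + case: eqP => // e1; case: eqP => // e2; exfalso; case/negP: n0; apply/eqP.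
    by apply: (mulfI l0); apply: (lincomb2 (c := 1) (c' := 1) e1 e2); ring2.
  + by do 2!case: eqP.
- apply/forall_inP => m /sublines_bplane[->|[p [d [pb dd ->]]]].
    by rewrite card_derivation.
  by rewrite card_dline.
Qed.

Lemma baer_line_new : aff @: baer_line w l \in new_lines F q.
Proof.
apply/imsetP; exists B; first by rewrite inE bplane_order subsetUl.
apply/setP => P; apply/imsetP/setDP => [[p pb ->]|[PB PI]].
  by rewrite aff_bplane aff_line_inf.
case: (pg_cases (subsetP bplane_pg _ PB)) => [[p eP]|[u u0 eP]].
  by exists p => //; rewrite -aff_bplane -eP.
by rewrite eP inf_line_inf u0 in PI.
Qed.

End BaerLineSubplane.

Lemma new_linesP m : reflect (exists w l, l != 0 /\ m = aff @: baer_line w l)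
  (m \in new_lines F q).
Proof.
apply: (iffP idP) => [/imsetP[B]|[w [l [l0 ->]]]]; last exact: baer_line_new.
by rewrite inE => /andP[/subplane_baer_line H /H [w [l [l0 ?]]] ->]; exists w, l.
Qed.

Lemma old_linesP m : m \in old_lines F q -> exists c0 c1 c2,
  (c0 != 0) || (c1 != 0) /\ forall p, (aff p \in m) = (c0 * p.1 + c1 * p.2 + c2 == 0).
Proof.
case/imsetP => L; rewrite inE => /and3P[pL nL _] ->.
move: pL nL => /pg_linesP[c0 [c1 [c2 [-> nz]]]] nL; exists c0, c1, c2; split.
  rewrite -negb_and; apply: contra nL => /andP[/eqP z0 /eqP z1].
  by rewrite z0 z1 !eqxx /= in nz; rewrite z0 z1 line_inf_scaled.
by move=> p; rewrite in_setD aff_line_inf aff_line.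
Qed.

(** * The normal form of a conic *)

Lemma zero_locus_hpoint a b c d e f (x y z : F) :
  (hpoint x y z \in zero_locus (quad3 a%:MP b%:MP c%:MP d%:MP e%:MP f%:MP
    'X_0 'X_1 'X_(2%:R))) =
  ~~ [&& x == 0, y == 0 & z == 0] && (quad3 a b c d e f x y z == 0).
Proof.
have ev (v : 'rV[F]_3) : (quad3 a%:MP b%:MP c%:MP d%:MP e%:MP f%:MP
    'X_0 'X_1 'X_(2%:R)).@[fun i => v 0 i] =
    quad3 a b c d e f (v 0 0) (v 0 1) (v 0 2%:R).
  by rewrite /quad3 !expr2 !(mevalD, mevalM, mevalC, mevalXU).
apply/imsetP/andP => [[v]|[nz /eqP Q0]]; last first.
  exists (rv x y z) => //; rewrite inE rv_eq0 nz ev !mxE /=; exact/eqP.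
rewrite inE ev => /andP[v0 /eqP Q0] e0.
rewrite -hpoint_pg e0 pg_pointP; split=> //.
move: e0; rewrite (rvP v) -hpointE => /hpoint_inj[t [-> -> ->]].
by rewrite quad3_hom Q0 mulr0.
Qed.

(** If b = 0, the form at infinity is the square of a linear form, with 1 or all
    q^2 + 1 zeros.  Otherwise (e/b : d/b : 1) is the nucleus; translating it to
    the origin removes the linear terms, and the remaining constant is nonzero
    by [centre_off_conic]. *)
Lemma conic_normal_form (K : {set 'M[F]_3}) : is_conic K ->
  #|K :&: line_inf F| = 0%N \/ #|K :&: line_inf F| = 2 ->
  exists a b c p0, [/\ b != 0, K \subset pg_points F,
    forall u, u != (0, 0) -> (inf u \in K) = (N a b c u == 0) &
    forall p, (aff (vec p0 p) \in K) = (N a b c p == 1)].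
Proof.
case=> Q [/quad3P[a [b [c [d [e [f eQ]]]]]] irr eK] cK.
rewrite {}eQ in irr eK.
have Kpg : K \subset pg_points F.
  apply/subsetP => P; rewrite eK => /imsetP[v]; rewrite inE => /andP[v0 _] ->.
  by rewrite pg_pointP.
have infK u : u != (0, 0) -> (inf u \in K) = (N a b c u == 0).
  move=> u0; rewrite eK zero_locus_hpoint eqxx andbT -xpair_eqE -surjective_pairing u0.
  congr (_ == _); rewrite /quad3 /N; ring2.
have infKI u : u != (0, 0) -> N a b c u = 0 -> inf u \in K :&: line_inf F.
  by move=> u0 Nu; rewrite in_setI infK // Nu eqxx inf_line_inf.
have b0 : b != 0.
  apply/eqP => b0; have [s es] := sqrt_exists a; have [t et] := sqrt_exists c.
  have NE u : N a b c u = (s * u.1 + t * u.2) ^+ 2 by rewrite /N b0 -es -et; ring2.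
  case: cK => cK.
    have [u u0 Nu] : exists2 u, u != (0, 0) & N a b c u = 0.
      case: (eqVneq (t, s) (0, 0)) => [[t0 s0]|ts]; last first.
        by exists (t, s) => //; rewrite NE /=; ring2.
      exists (1, 0); first by rewrite xpair_eqE oner_eq0.
      by rewrite NE t0 s0 /=; ring2.
    by have := infKI u u0 Nu; rewrite (cards0_eq cK) in_set0.
  have /card_gt1P[P [R [PK RK PR]]] : (1 < #|K :&: line_inf F|)%N by rewrite cK.
  have root X : X \in K :&: line_inf F ->
      exists u, [/\ u != (0, 0), X = inf u & N a b c u = 0].
    case/setIP=> XK XI; case: (pg_cases (subsetP Kpg _ XK)) => [[p eP]|[u u0 eP]].
      by rewrite eP (negPf (aff_line_inf _)) in XI.
    by exists u; split=> //; apply/eqP; rewrite -infK // -eP.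
  have [u [u0 eu Nu]] := root P PK; have [v [v0 ev Nv]] := root R RK.
  have duv : det u v != 0 by apply: contra_neq PR => z; rewrite eu ev; exact: det_inf.
  have uv0 : vec u v != (0, 0).
    by rewrite vec_eq0; apply: contraNneq duv => ->; rewrite detuu.
  have Nuv : N a b c (vec u v) = 0.
    by apply: (lincomb2 (c := 1) (c' := 1) Nu Nv); rewrite !NE /vec /=; ring2.
  have ne1 : inf u != inf (vec u v).
    apply: contraNneq duv => /inf_det z; apply/eqP.
    by apply: (lincomb1 (c := 1) z); rewrite /det /vec /=; ring2.
  have ne2 : inf v != inf (vec u v).
    apply: contraNneq duv => /inf_det z; apply/eqP.
    by apply: (lincomb1 (c := 1) z); rewrite /det /vec /=; ring2.
  rewrite eu ev in PK RK PR.
  by move/eqP: ne2; apply; apply: (card2_eq cK PK RK (infKI _ uv0 Nuv)).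
(* The nucleus, where all partial derivatives vanish. *)
pose x0 := e / b; pose y0 := d / b.
have ed : d = b * y0 by rewrite mulrC divfK.
have ee : e = b * x0 by rewrite mulrC divfK.
have g0 : N a b c (x0, y0) + f != 0.
  by apply: (centre_off_conic two_eq0); rewrite -ed -ee.
set g := _ + f in g0.
have Ng u : N (a / g) (b / g) (c / g) u = N a b c u / g.
  by rewrite /N !mulrDl -!mulrA !(mulrCA g^-1) ![g^-1 * _]mulrC.
exists (a / g), (b / g), (c / g), (x0, y0); split=> //.
- by rewrite mulf_neq0 ?invr_eq0.
- by move=> u u0; rewrite infK // Ng mulf_eq0 invr_eq0 (negPf g0) orbF.
move=> p; rewrite eK zero_locus_hpoint oner_eq0 !andbF /= Ng.
rewrite -[RHS](inj_eq (mulIf g0)) divfK // mul1r -[RHS]addr_eq02; congr (_ == _).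
by rewrite /g ed ee /quad3 /N /=; ring2.
Qed.

Lemma line_inf_conic_inf (K : {set 'M[F]_3}) P : P \in K :&: line_inf F ->
  K \subset pg_points F -> exists2 u, u != (0, 0) & P = inf u.
Proof.
case/setIP=> PK PI sK; case: (pg_cases (subsetP sK _ PK)) => [[p eP]|//].
by rewrite eP (negPf (aff_line_inf _)) in PI.
Qed.

(** * Hall lines and the conic in normal form *)

Section NormalForm.
Variables (K : {set 'M[F]_3}) (a b c : F) (p0 : F * F).
Hypotheses (b0 : b != 0) (Kpg : K \subset pg_points F).
Hypothesis infK : forall u, u != (0, 0) -> (inf u \in K) = (N a b c u == 0).
Hypothesis affK : forall p, (aff (vec p0 p) \in K) = (N a b c p == 1).

Let affc p := aff (vec p0 p).

Lemma vecK p : vec p0 (vec p0 p) = p.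
Proof. by apply: pairE; rewrite /vec /=; ring2. Qed.

Lemma affc_inj : injective affc.
Proof. by move=> p r /aff_inj/(congr1 (vec p0)); rewrite !vecK. Qed.

Lemma affine_partE : affine_part K = affc @: unit_conic a b c.
Proof.
apply/setP => P; apply/setDP/imsetP => [[PK PI]|[p]].
  case: (pg_cases (subsetP Kpg _ PK)) => [[p eP]|[u u0 eP]].
    exists (vec p0 p); last by rewrite /affc vecK.
    by rewrite inE -affK vecK -eP.
  by rewrite eP inf_line_inf u0 in PI.
by rewrite inE => Np ->; rewrite affK; split=> //; exact: aff_line_inf.
Qed.

Lemma baer_line_centre w l : aff @: baer_line w l = affc @: baer_line (vec p0 w) l.
Proof.
rewrite /baer_line -!imset_comp; apply: eq_imset => u /=; congr aff.
by apply: pairE; rewrite /vec /step /=; ring2.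
Qed.

Lemma card_new_line w l :
  #|(aff @: baer_line w l) :&: affine_part K| =
  #|baer_line (vec p0 w) l :&: unit_conic a b c|.
Proof.
rewrite baer_line_centre affine_partE -imsetI; last by move=> ? ? _ _; exact: affc_inj.
by rewrite card_imset //; exact: affc_inj.
Qed.

Lemma card_old_line m : m \in old_lines F q -> (#|m :&: affine_part K| <= 2)%N.
Proof.
move=> /old_linesP[c0 [c1 [c2 [nz mE]]]].
pose c3 := c2 + c0 * p0.1 + c1 * p0.2.
apply: leq_trans (line_conic_le2 a c b0 c3 nz).
rewrite -(card_imset _ affc_inj); apply/subset_leq_card/subsetP => P.
rewrite affine_partE => /setIP[Pm /imsetP[p Cp eP]]; rewrite eP; apply: imset_f.
rewrite inE Cp /=; move: Pm; rewrite eP mE => /eqP e; apply/eqP.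
by rewrite -[RHS]e /c3 /vec /=; ring2.
Qed.

Lemma card_hall_line n m : (2 <= n)%N ->
  (forall w l, l != 0 -> (#|baer_line w l :&: unit_conic a b c| <= n)%N) ->
  m \in hall_lines F q -> (#|m :&: affine_part K| <= n)%N.
Proof.
move=> n2 H /setUP[/card_old_line h2|/new_linesP[w [l [l0 ->]]]].
  exact: leq_trans h2 n2.
by rewrite card_new_line H.
Qed.

(** A triple on an ordinary line is excluded by [card_old_line], and every other
    Hall line is a translate of some [baer_line]. *)
Lemma card_triples :
  #|collinear_triples q (affine_part K)| = 'C(#|free_dirs a b c|, 3).
Proof.
rewrite -card_baer_triples //.
rewrite -(card_imset (mem (baer_triples a b c)) (imset_inj affc_inj)).
apply: eq_card => T; rewrite inE; apply/and3P/imsetP.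
  case=> sT /eqP cT /existsP[m /andP[mH sm]].
  move: mH => /setUP[mo|/new_linesP[w [l [l0 em]]]].
    have : (#|T| <= #|m :&: affine_part K|)%N by rewrite subset_leq_card // subsetI sm.
    by rewrite cT => /leq_trans/(_ (card_old_line mo)).
  pose T' := [set p | affc p \in T].
  have eT : T = affc @: T'.
    apply/setP => P; apply/idP/imsetP => [PT|[p]]; last by rewrite inE => pT ->.
    have := subsetP sT _ PT; rewrite affine_partE => /imsetP[p _ eP].
    by exists p; rewrite // inE -eP.
  exists T' => //; rewrite inE; apply/and3P; split.
  - apply/subsetP => p; rewrite inE => /(subsetP sT); rewrite affine_partE.
    by rewrite (mem_imset _ _ affc_inj).
  - by rewrite -(card_imset _ affc_inj) -eT cT.
  apply/existsP; exists (vec p0 w); apply/existsP; exists l; rewrite l0.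
  apply/subsetP => p; rewrite inE => /(subsetP sm).
  by rewrite em baer_line_centre (mem_imset _ _ affc_inj).
case=> T'; rewrite inE => /and3P[sT cT /existsP[w /existsP[l /andP[l0 sl]]]] ->.
rewrite affine_partE (imsetS _ sT) (card_imset _ affc_inj) cT; split=> //.
apply/existsP; exists (affc @: baer_line w l); rewrite (imsetS _ sl) andbT.
rewrite -[w]vecK -baer_line_centre; apply/setUP; right.
by apply/new_linesP; exists (vec p0 w), l.
Qed.

Lemma card_free_dirs : (#|free_dirs a b c| + #|K :&: derivation_set F q| = q.+1)%N.
Proof.
have -> : K :&: derivation_set F q = inf @: [set d in dirs | N a b c d == 0].
  rewrite derivationE; apply/setP => P.
  apply/setIP/imsetP => [[PK /imsetP[d dd eP]]|[d]].
    by exists d => //; rewrite inE dd -infK ?dirs_neq0 // -eP.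
  by rewrite inE => /andP[dd Nd] ->; rewrite infK ?dirs_neq0 // imset_f.
rewrite card_in_imset.
  rewrite -card_dirs -(cardsID [set d | N a b c d == 0] dirs) addnC setIdE.
  congr addn; apply: eq_card => d; rewrite [LHS]inE in_setD.
  by rewrite (_ : (d \in [set x | N a b c x == 0]) = (N a b c d == 0))
       1?andbC // inE.
by rewrite setIdE => d d' /setIP[dd _] /setIP[dd' _]; apply: inf_dirs_inj.
Qed.

Lemma ellipse_not_rational : #|K :&: line_inf F| = 0%N -> ~~ rational a b c.
Proof.
move=> cK; apply/negP => /(rational_root b0)[u u0 Nu].
have : inf u \in K :&: line_inf F by rewrite in_setI infK // Nu eqxx inf_line_inf.
by rewrite (cards0_eq cK) in_set0.
Qed.

(** A direction is in D when it is fixed by conjugation. *)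
Lemma inf_derivation u : u != (0, 0) ->
  (inf u \in derivation_set F q) = (det u (conjv u) == 0).
Proof.
move=> u0; rewrite derivationE; apply/imsetP/eqP => [[d dd /inf_det e]|e].
  have [t ->] := det0P (dirs_neq0 dd) (etrans (detC _ _) e).
  have [e1 e2] : d.1 ^+ q = d.1 /\ d.2 ^+ q = d.2.
    by have := dirs_conjv dd; case: (d) => x y [].
  by rewrite /det /conjv /step /= !add0r !exprMn e1 e2; move: (t ^+ q) => s; ring2.
exists (norm u); last by rewrite inf_norm.
case: u u0 e => x y u0; rewrite /norm /det /=; case: (eqVneq x 0) => [x0|x0] e /=.
  by rewrite !inE eqxx.
apply/setU1P; right; apply/imsetP; exists (y / x) => //.
rewrite inGFq exprMn exprVn -(inj_eq (mulIf x0)) divfK // mulrAC.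
have xq : x ^+ q != 0 by rewrite expf_neq0.
rewrite -(inj_eq (mulIf xq)) divfK //; apply/eqP.
by apply: (lincomb1 (c := 1) e); move: (x ^+ q) (y ^+ q) => s t; ring2.
Qed.

(** Conjugation permutes the zeros of a form over GF(q) and moves those outside D. *)
Lemma hyperbola_conj u R : #|K :&: line_inf F| = 2 -> rational a b c ->
  u != (0, 0) -> inf u \in K -> inf u \notin derivation_set F q ->
  R \in K :&: line_inf F -> inf u != R -> R = inf (conjv u).
Proof.
move=> cK rat u0 uK uD RK uR; have cu0 := conjv_neq0 u0.
have uI : inf u \in K :&: line_inf F by rewrite in_setI uK inf_line_inf.
have cuI : inf (conjv u) \in K :&: line_inf F.
  rewrite in_setI infK // inf_line_inf cu0 andbT.
  by rewrite rational_conj //; apply/eqP; rewrite -infK.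
apply: (card2_eq cK uI RK cuI uR); apply: contraNneq uD => /inf_det e.
by rewrite inf_derivation // e.
Qed.

End NormalForm.

(** * The theorem *)

Lemma hall_conic (K : {set 'M[F]_3}) : is_conic K ->
  ((is_hyperbola K /\
      (exists P R : 'M[F]_3,
         [/\ P \in (K :&: line_inf F) :\: derivation_set F q,
             R \in (K :&: line_inf F) :\: derivation_set F q,
             P != R & ~~ conjugate_points q P R])
    \/ is_ellipse K) ->
     (forall l : {set 'M[F]_3}, l \in hall_lines F q ->
        (#|l :&: affine_part K| <= 4)%N) /\
     #|collinear_triples q (affine_part K)| = 'C(q.+1, 3))
  /\
  (is_hyperbola K /\ #|K :&: derivation_set F q| = 1%N ->
     (forall l : {set 'M[F]_3}, l \in hall_lines F q ->
        (#|l :&: affine_part K| <= 3)%N) /\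
     #|collinear_triples q (affine_part K)| = 'C(q, 3)).
Proof.
move=> hK.
have sD := derivation_line_inf.
split.
  move=> hyp.
  have cK : #|K :&: line_inf F| = 0%N \/ #|K :&: line_inf F| = 2.
    by case: hyp => [[[_ ->] _]|[_ ->]]; [right | left].
  have [a [b [c [p0 [b0 Kpg infK affK]]]]] := conic_normal_form hK cK.
  have [KD nr] : #|K :&: derivation_set F q| = 0%N /\ ~~ rational a b c.
    case: hyp => [[[_ {}cK] [P [R [PKD RKD PR nc]]]]|[_ {}cK]]; last first.
      split; last exact: (ellipse_not_rational b0 infK).
      apply/eqP; rewrite -leqn0; apply: leq_trans (_ : #|K :&: line_inf F| <= 0)%N.
        by rewrite subset_leq_card // setIS.
      by rewrite cK.
    move: PKD RKD; rewrite !in_setD => /andP[PD PK] /andP[RD RK].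
    split.
      apply/eqP; rewrite cards_eq0 -subset0; apply/subsetP => X /setIP[XK XD].
      have XI : X \in K :&: line_inf F by rewrite in_setI XK (subsetP sD).
      case: (eqVneq P X) => [e|PX]; first by rewrite e XD in PD.
      by rewrite (card2_eq cK PK RK XI PR PX) XD in RD.
    apply/negP => rat; case/negP: nc.
    have [u u0 eP] := line_inf_conic_inf PK Kpg.
    have uK : inf u \in K by rewrite -eP; case/setIP: PK.
    rewrite {}eP in PR PD *.
    rewrite (hyperbola_conj b0 infK cK rat u0 uK PD RK PR).
    apply/andP; split; apply/existsP.
      by exists u; rewrite u0 !eqxx.
    exists (conjv u); rewrite conjv_neq0 // eqxx /=.
    by rewrite !conjK.
  have gd : #|free_dirs a b c| = q.+1.
    by have := card_free_dirs infK; rewrite KD addn0.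
  split; last by rewrite (card_triples b0 Kpg affK) gd.
  move=> l; apply: (card_hall_line b0 Kpg affK) => // w m m0.
  exact: (baer_line_le4 b0).
case=> [[_ cK] cD].
have [a [b [c [p0 [b0 Kpg infK affK]]]]] := conic_normal_form hK (or_intror cK).
have gd : #|free_dirs a b c| = q.
  by have := card_free_dirs infK; rewrite cD addn1 => -[].
have [R KDR] : exists R, R \in K :&: derivation_set F q by apply/card_gt0P; rewrite cD.
have [RK RD] := setIP KDR.
have RI : R \in K :&: line_inf F by rewrite in_setI RK (subsetP sD).
have nr : ~~ rational a b c.
  apply/negP => rat.
  have [P PK PD] : exists2 P, P \in K :&: line_inf F & P \notin derivation_set F q.
    have : (0 < #|(K :&: line_inf F) :\: derivation_set F q|)%N.
      have := cardsID (derivation_set F q) (K :&: line_inf F).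
      rewrite cK -setIA (setIidPr sD) cD; lia.
    by case/card_gt0P => P /setDP[PK PD]; exists P.
  have [u u0 eP] := line_inf_conic_inf PK Kpg.
  have uK : inf u \in K by rewrite -eP; case/setIP: PK.
  have uR : inf u != R by rewrite -eP; apply: contraNneq PD => ->.
  rewrite {}eP in PD.
  have eR := hyperbola_conj b0 infK cK rat u0 uK PD RI uR.
  case/negP: PD; move: RD; rewrite eR !inf_derivation ?conjv_neq0 //.
  by rewrite conjvK detC.
have [r [rk r0 Nr]] : exists r, [/\ r \in GFqvec, r != (0, 0) & N a b c r = 0].
  move: RD; rewrite derivationE => /imsetP[d dd eR]; exists d.
  rewrite (dirs_GFqvec dd) (dirs_neq0 dd); split=> //; apply/eqP.
  by rewrite -infK ?(dirs_neq0 dd) // -eR.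
split; last by rewrite (card_triples b0 Kpg affK) gd.
move=> l; apply: (card_hall_line b0 Kpg affK) => // w m m0.
exact: (baer_line_le3 b0 _ m0 nr rk r0 Nr).
Qed.

End HallPlane.

Theorem theorem4p2 (q h : nat) (F : finFieldType)
    (hq2 : q = (2 ^ h)%N) (hq4 : (4 <= q)%N) (hF : #|F| = (q ^ 2)%N)
    (K : {set 'M[F]_3}) (hK : is_conic K) :
  ((is_hyperbola K /\
      (exists P R : 'M[F]_3,
         [/\ P \in (K :&: line_inf F) :\: derivation_set F q,
             R \in (K :&: line_inf F) :\: derivation_set F q,
             P != R & ~~ conjugate_points q P R])
    \/ is_ellipse K) ->
     (forall l : {set 'M[F]_3}, l \in hall_lines F q ->
        (#|l :&: affine_part K| <= 4)%N) /\
     #|collinear_triples q (affine_part K)| = 'C(q.+1, 3))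
  /\
  (is_hyperbola K /\ #|K :&: derivation_set F q| = 1%N ->
     (forall l : {set 'M[F]_3}, l \in hall_lines F q ->
        (#|l :&: affine_part K| <= 3)%N) /\
     #|collinear_triples q (affine_part K)| = 'C(q, 3)).
Proof. exact: (hall_conic hq2 hq4 hF hK). Qed.
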